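(* Let $S^2\subset\mathbb{R}^3$ be the unit sphere, let $e_3=(0,0,1)$, and let $SO(2)$ act on $S^2$ by rotations about $e_3$ and on $T^*S^2$ by the lifted action. Let $V\in C^\infty(S^2)^{SO(2)}$ be an $SO(2)$-invariant smooth function, and let $W\in C^\infty([0,1))$ be the unique function with $$W(u^2)=V(u,0,\sqrt{1-u^2})\qquad\text{for all }u\in[0,1).$$ Consider the 1-parameter family of $SO(2)$-invariant Hamiltonian systems $$\Big\{\big(T^*S^2,\ \omega_{T^*S^2}+r\,\omega_{S^2},\ h(q,p)=\tfrac12 g_q^*(p,p)+V(q)\big)\Big\}_{r\ge 0},$$ where $\omega_{T^*S^2}$ is the canonical symplectic form, $\omega_{S^2}$ is the standard area form on the sphere (pulled back to $T^*S^2$), $g$ is the standard round metric and $g^*$ is the dual metric. Then: (i) If $W'(0)>0$, then the point $(e_3,0)\in T^*S^2$ (the ''straight up top'') is stable for all values of $r\ge 0$. (ii) Suppose $W'(0)<0$ and $W''(0)>W'(0)$, and set $r_0:=\sqrt{-8W'(0)}$. Then for $r>r_0$ the point $(e_3,0)$ is stable. For $0\le r<r_0$ the point $(e_3,0)$ is unstable, and as $r$ decreases below $r_0$ a branch of stable relative equilibria bifurcates off $(e_3,0)$: there are $\delta>0$, a continuous function $u:(r_0-\delta,r_0)\to(0,1)$ with $u(r)\to0$ as $r\to r_0^-$, and for each $r\in(r_0-\delta,r_0)$ a stable relative equilibrium $x_r\in T^*S^2$ of the system with parameter $r$, lying over the point $(u(r),0,\sqrt{1-u(r)^2})\in S^2$,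 with $x_r\to(e_3,0)$ as $r\to r_0^-$. (The paper calls this a ''Hamiltonian Hopf'' bifurcation.) (iii) Suppose $W'(0)<0$ and $W''(0)<W'(0)$, and set $r_0:=\sqrt{-8W'(0)}$. Then for $0\le r\le r_0$ the point $(e_3,0)$ is unstable, and for $r>r_0$ it is stable. Additionally, a branch of unstable relative equilibria bifurcates off $(e_3,0)$ as $r$ increases past $r_0$: there are $\delta>0$, a continuous function $u:(r_0,r_0+\delta)\to(0,1)$ with $u(r)\to0$ as $r\to r_0^+$, and for each $r\in(r_0,r_0+\delta)$ an unstable relative equilibrium $x_r\in T^*S^2$ of the system with parameter $r$, lying over $(u(r),0,\sqrt{1-u(r)^2})\in S^2$, with $x_r\to(e_3,0)$ as $r\to r_0^+$.
   Context: A function $\ell$ belongs to $C^\infty([0,1))$ iff there are $\varepsilon>0$ and $\tilde\ell\in C^\infty((-\varepsilon,1))$ with $\ell=\tilde\ell|_{[0,1)}$. For $V\in C^\infty(S^2)^{SO(2)}$ the existence and uniqueness of $W$ is a known consequence of a theorem of Whitney. The Hamiltonian vector field $\Xi_h$ of $h$ with respect to a symplectic form $\omega$ is defined by $\omega(\Xi_h,\cdot)=dh$. In the coordinates $(x,y)=(q_1,q_2)$ on the upper hemisphere and the induced cotangent coordinates $(x,y,p_x,p_y)$, the symplectic form is $\omega_{T^*S^2}+r\omega_{S^2}=dx\wedge dp_x+dy\wedge dp_y+\frac{r}{\sqrt{1-x^2-y^2}}\,dx\wedge dy$. A relative equilibrium of a $G$-invariant Hamiltonian system is a point whose Hamiltonian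 trajectory is contained in a single $G$-orbit. It is stable (relatively stable, $G$-stable) if for every $G$-invariant neighborhood $\mathcal{U}$ of its $G$-orbit there is a neighborhood $\mathcal{U}'$ of the orbit such that every trajectory starting in $\mathcal{U}'$ stays in $\mathcal{U}$ for all positive time; otherwise it is unstable. Here $G=SO(2)$. The point $(e_3,0)$ is fixed by $SO(2)$, so for it this is ordinary (Lyapunov) stability of an equilibrium. *)

(* Defs.v *)
From Stdlib Require Import Reals.
From Coquelicot Require Import Coquelicot.

Local Open Scope R_scope.

Definition R3 : Type := (R * R * R)%type.

Definition mk3 (x y z : R) : R3 := (x, y, z).
Definition c1 (a : R3) : R := fst (fst a).
Definition c2 (a : R3) : R := snd (fst a).
Definition c3 (a : R3) : R := snd a.

Definition dot (a b : R3) : R := c1 a * c1 b + c2 a * c2 b + c3 a * c3 b.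

Definition cross (a b : R3) : R3 :=
  mk3 (c2 a * c3 b - c3 a * c2 b)
      (c3 a * c1 b - c1 a * c3 b)
      (c1 a * c2 b - c2 a * c1 b).

Definition zero3 : R3 := mk3 0 0 0.
Definition e1 : R3 := mk3 1 0 0.
Definition e2 : R3 := mk3 0 1 0.
Definition e3 : R3 := mk3 0 0 1.

Definition S2 (q : R3) : Prop := dot q q = 1.

Definition is_partial (f : R3 -> R) (e x : R3) (d : R) : Prop :=
  is_derive (fun t : R => f (plus x (scal t e))) 0 d.

Fixpoint C_k_on (k : nat) (O : R3 -> Prop) (f : R3 -> R) : Prop :=
  (forall x, O x -> continuous f x) /\
  match k with
  | 0%nat => True
  | S k' => forall e, e = e1 \/ e = e2 \/ e = e3 ->
      exists g : R3 -> R,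
        C_k_on k' O g /\ (forall x, O x -> is_partial f e x (g x))
  end.

Definition C_infty_on (O : R3 -> Prop) (f : R3 -> R) : Prop :=
  forall k, C_k_on k O f.

(* Functions on the sphere are represented by functions on [R3] of which only
   the values on [S2] matter.  Smoothness on the embedded submanifold [S2]
   means: near each point, restriction of a smooth function of three
   variables. *)
Definition C_infty_S2 (V : R3 -> R) : Prop :=
  forall q, S2 q ->
    exists (O : R3 -> Prop) (F : R3 -> R),
      open O /\ O q /\ C_infty_on O F /\
      (forall y, O y -> S2 y -> V y = F y).

Definition C_infty_01 (l : R -> R) : Prop :=
  exists (eps : R) (l' : R -> R),
    0 < eps /\
    (forall (n : nat) (t : R), - eps < t < 1 -> ex_derive_n l' n t) /\
    (forall t, 0 <= t < 1 -> l t = l' t).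

(* For [l] in [C_infty_01], the derivative on [0,1), including the boundary
   point 0, is the right derivative. *)
Definition is_right_derive (l : R -> R) (x d : R) : Prop :=
  filterlim (fun h => (l (x + h) - l x) / h) (at_right 0) (locally d).

Definition right_derive (l : R -> R) (x : R) : R := iota (is_right_derive l x).

Definition rot (theta : R) (a : R3) : R3 :=
  mk3 (cos theta * c1 a - sin theta * c2 a)
      (sin theta * c1 a + cos theta * c2 a)
      (c3 a).

Definition SO2_invariant (V : R3 -> R) : Prop :=
  forall theta q, S2 q -> V (rot theta q) = V q.

(* [T*S2] is embedded in [R3 * R3]: the covector [g_q(p, .)] at [q] is
   represented by the tangent vector [p], orthogonal to [q].  Hence
   [g*_q(p,p) = dot p p], and the lifted action of a rotation, which is an
   isometry, is diagonal. *)
Definition phase : Type := (R3 * R3)%type.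

Definition TS2 (x : phase) : Prop := S2 (fst x) /\ dot (fst x) (snd x) = 0.

Definition lifted_rot (theta : R) (x : phase) : phase :=
  (rot theta (fst x), rot theta (snd x)).

Definition orbit (x y : phase) : Prop := exists theta, y = lifted_rot theta x.

(* Tangent space of [TS2] at [x]: the linearization of [dot q q = 1] and
   [dot q p = 0]. *)
Definition tangent (x xi : phase) : Prop :=
  dot (fst x) (fst xi) = 0 /\
  dot (fst xi) (snd x) + dot (fst x) (snd xi) = 0.

(* The tautological one-form of [T*S2] is the restriction of [p . dq], so the
   canonical form [- d(p . dq)] is the restriction of [sum_i dq_i /\ dp_i]. *)
Definition omega_can (xi eta : phase) : R :=
  dot (fst xi) (snd eta) - dot (fst eta) (snd xi).

(* The area form of the sphere oriented by its outer normal, pulled back;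
   in the coordinates [(x, y)] of the upper hemisphere it is
   [dx /\ dy / sqrt (1 - x^2 - y^2)]. *)
Definition omega_S2 (x xi eta : phase) : R :=
  dot (fst x) (cross (fst xi) (fst eta)).

Definition omega (r : R) (x xi eta : phase) : R :=
  omega_can xi eta + r * omega_S2 x xi eta.

Definition hamiltonian (V : R3 -> R) (x : phase) : R :=
  / 2 * dot (snd x) (snd x) + V (fst x).

(* [L] is the differential at [x] of the function [h] on the manifold [TS2]:
   the tangent vectors are the velocities [v] of curves in [TS2] through
   [x]. *)
Definition is_differential (h : phase -> R) (x : phase) (L : phase -> R) : Prop :=
  forall (c : R -> phase) (v : phase),
    (forall s, TS2 (c s)) -> c 0 = x -> is_derive c 0 v ->
    is_derive (fun s => h (c s)) 0 (L v).

Definition is_hamiltonian_vector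
    (r : R) (h : phase -> R) (x xi : phase) : Prop :=
  tangent x xi /\ is_differential h x (omega r x xi).

Definition trajectory
    (r : R) (V : R3 -> R) (a b : Rbar) (gamma : R -> phase) : Prop :=
  forall t : R, Rbar_lt a t -> Rbar_lt t b ->
    TS2 (gamma t) /\
    exists xi, is_hamiltonian_vector r (hamiltonian V) (gamma t) xi /\
               is_derive gamma t xi.

Definition relative_equilibrium (r : R) (V : R3 -> R) (x : phase) : Prop :=
  exists gamma : R -> phase,
    trajectory r V m_infty p_infty gamma /\ gamma 0 = x /\
    (forall t, orbit x (gamma t)).

Definition orbit_neighborhood (x : phase) (U : phase -> Prop) : Prop :=
  forall y, orbit x y -> within TS2 (locally y) U.

Definition invariant_set (U : phase -> Prop) : Prop :=
  forall theta y, TS2 y -> U y -> U (lifted_rot theta y).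

Definition G_stable (r : R) (V : R3 -> R) (x : phase) : Prop :=
  forall U : phase -> Prop, invariant_set U -> orbit_neighborhood x U ->
    exists U' : phase -> Prop, orbit_neighborhood x U' /\
      forall (a b : Rbar) (gamma : R -> phase),
        Rbar_lt a 0 -> Rbar_lt 0 b -> trajectory r V a b gamma ->
        U' (gamma 0) ->
        forall t : R, 0 <= t -> Rbar_lt t b -> U (gamma t).

Definition stable_re (r : R) (V : R3 -> R) (x : phase) : Prop :=
  relative_equilibrium r V x /\ G_stable r V x.

Definition unstable_re (r : R) (V : R3 -> R) (x : phase) : Prop :=
  relative_equilibrium r V x /\ ~ G_stable r V x.

Definition straight_up_top : phase := (e3, zero3).

Definition meridian_point (u : R) : R3 := mk3 u 0 (sqrt (1 - u ^ 2)).

(* Main.v *)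
(* In the embedded picture the Hamiltonian vector field conserves the energy [h]
   and the momentum [J = (q x p)_3 - r (1 - z)], where [z] is the height. Writing
   [V = l (1 - z^2)] on the upper hemisphere, completing the square gives
     [h - Om J = / 2 * |p - Om e3 x q|^2 + A z],
     [A z = - / 2 * Om^2 (1 - z^2) + Om r (1 - z) + l (1 - z^2)].
   A uniform rotation with angular velocity [Om] at height [zs] is a relative
   equilibrium when [A' zs = 0] (or at the pole, for every [Om]). If [A] has a
   strict minimum at [zs], then [h - Om J] is a Lyapunov function. If
   [Om = r / (2 zs)] and [A] drops at least quadratically below [zs], then the
   trajectories with the energy and the momentum of the relative equilibrium can
   be integrated by quadrature, and they leave its neighborhood although they
   start arbitrarily close to it.
   At the pole, [Om = r / 2] gives [A' 1 = - (r^2 / 4 + 2 W' 0)], which decides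
   the stability for [r <> r0]. The bifurcating branch consists of the points with
   [s = 1 - z^2] and [r^2 = - 8 (1 - s) W' s], where the equation for the angular
   velocity has the double root [Om = r / (2 z)]; there [A' = 0] and
   [A'' = 4 ((1 - s) W'' s - W' s)] has the sign of [W'' 0 - W' 0]. *)

Require Import Defs.
From Stdlib Require Import Reals Lra Nsatz.
From Coquelicot Require Import Coquelicot.
(* [Reals] has its own [c1], which would shadow the first coordinate. *)
Import Defs.

Local Open Scope R_scope.

(** * Curves in phase space and conservation laws *)

Lemma is_derive_Rmult (f g : R -> R) x df dg :
  is_derive f x df -> is_derive g x dg ->
  is_derive (fun y => f y * g y) x (df * g x + f x * dg).
Proof. intros; apply (is_derive_mult (K := R_AbsRing)); auto; exact Rmult_comm. Qed.

Lemma is_derive_Rplus (f g : R -> R) x df dg :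
  is_derive f x df -> is_derive g x dg -> is_derive (fun y => f y + g y) x (df + dg).
Proof. intros; apply (is_derive_plus (K := R_AbsRing) (V := R_NormedModule)); assumption. Qed.

Lemma is_derive_Rminus (f g : R -> R) x df dg :
  is_derive f x df -> is_derive g x dg -> is_derive (fun y => f y - g y) x (df - dg).
Proof. intros; apply (is_derive_minus (K := R_AbsRing) (V := R_NormedModule)); assumption. Qed.

Lemma is_derive_Rcomp (f g : R -> R) x df dg :
  is_derive f (g x) df -> is_derive g x dg -> is_derive (fun y => f (g y)) x (dg * df).
Proof. intros; apply (is_derive_comp (K := R_AbsRing) (V := R_NormedModule)); assumption. Qed.

Lemma is_derive_Rconst (a x : R) : is_derive (fun _ : R => a) x 0.
Proof. apply (is_derive_const (K := R_AbsRing) (V := R_NormedModule)). Qed.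

(** Meant for goals whose derivative is an evar introduced by [evar_last]: the sum and product rules
    fill it in, and hypotheses close the leaves. *)
Ltac derive_arith :=
  lazymatch goal with
  | |- is_derive (fun s => @?f s * @?g s) _ _ => apply (is_derive_Rmult f g); derive_arith
  | |- is_derive (fun s => @?f s + @?g s) _ _ => apply (is_derive_Rplus f g); derive_arith
  | |- is_derive (fun s => @?f s - @?g s) _ _ => apply (is_derive_Rminus f g); derive_arith
  | |- is_derive (fun _ => ?a) _ _ => apply (is_derive_Rconst a)
  | |- _ => eassumption
  end.

Lemma is_derive_pair {U V : NormedModule R_AbsRing} (f : R -> U) (g : R -> V) t df dg :
  is_derive f t df -> is_derive g t dg ->
  @is_derive R_AbsRing (prod_NormedModule R_AbsRing U V)
    (fun s => (f s, g s)) t (df, dg).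
Proof.
intros Hf Hg.
apply (filterdiff_comp'_2 f g (fun a b => (a, b)) t
  (fun y => scal y df) (fun y => scal y dg) (fun a b => (a, b)) Hf Hg).
apply (filterdiff_linear (fun t : U * V => (fst t, snd t))).
apply is_linear_prod; [apply is_linear_fst | apply is_linear_snd].
Qed.

Lemma is_derive_fst {U V : NormedModule R_AbsRing} (f : R -> U * V) t d :
  @is_derive R_AbsRing (prod_NormedModule R_AbsRing U V) f t d ->
  is_derive (fun s => fst (f s)) t (fst d).
Proof.
intros Hf.
apply (filterdiff_comp' (V := prod_NormedModule R_AbsRing U V)
  f fst t (fun y => scal y d) fst Hf).
apply filterdiff_linear, is_linear_fst.
Qed.

Lemma is_derive_snd {U V : NormedModule R_AbsRing} (f : R -> U * V) t d :
  @is_derive R_AbsRing (prod_NormedModule R_AbsRing U V) f t d ->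
  is_derive (fun s => snd (f s)) t (snd d).
Proof.
intros Hf.
apply (filterdiff_comp' (V := prod_NormedModule R_AbsRing U V)
  f snd t (fun y => scal y d) snd Hf).
apply filterdiff_linear, is_linear_snd.
Qed.

Lemma is_derive_phase (g : R -> phase) (t : R) (v : phase) :
  is_derive g t v ->
  (is_derive (fun s => c1 (fst (g s))) t (c1 (fst v)) /\
   is_derive (fun s => c2 (fst (g s))) t (c2 (fst v)) /\
   is_derive (fun s => c3 (fst (g s))) t (c3 (fst v))) /\
  (is_derive (fun s => c1 (snd (g s))) t (c1 (snd v)) /\
   is_derive (fun s => c2 (snd (g s))) t (c2 (snd v)) /\
   is_derive (fun s => c3 (snd (g s))) t (c3 (snd v))).
Proof.
intros H.
pose proof (is_derive_fst _ _ _ H) as Hq; pose proof (is_derive_snd _ _ _ H) as Hp.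
split; (split; [|split]).
- exact (is_derive_fst _ _ _ (is_derive_fst _ _ _ Hq)).
- exact (is_derive_snd _ _ _ (is_derive_fst _ _ _ Hq)).
- exact (is_derive_snd _ _ _ Hq).
- exact (is_derive_fst _ _ _ (is_derive_fst _ _ _ Hp)).
- exact (is_derive_snd _ _ _ (is_derive_fst _ _ _ Hp)).
- exact (is_derive_snd _ _ _ Hp).
Qed.

Lemma is_derive_mk_phase (q1 q2 q3 p1 p2 p3 : R -> R) t d1 d2 d3 d4 d5 d6 :
  is_derive q1 t d1 -> is_derive q2 t d2 -> is_derive q3 t d3 ->
  is_derive p1 t d4 -> is_derive p2 t d5 -> is_derive p3 t d6 ->
  is_derive (fun s => (mk3 (q1 s) (q2 s) (q3 s), mk3 (p1 s) (p2 s) (p3 s)) : phase)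
    t (mk3 d1 d2 d3, mk3 d4 d5 d6).
Proof.
intros; unfold mk3.
apply @is_derive_pair; apply @is_derive_pair; try apply @is_derive_pair; assumption.
Qed.

Lemma continuous_mk_phase {T : UniformSpace} (q1 q2 q3 p1 p2 p3 : T -> R) (t : T) :
  continuous q1 t -> continuous q2 t -> continuous q3 t ->
  continuous p1 t -> continuous p2 t -> continuous p3 t ->
  continuous (fun s => (mk3 (q1 s) (q2 s) (q3 s), mk3 (p1 s) (p2 s) (p3 s)) : phase) t.
Proof.
assert (pair_cont : forall (A B : UniformSpace) (f : T -> A) (g : T -> B),
  continuous f t -> continuous g t ->
  @continuous T (prod_UniformSpace A B) (fun s => (f s, g s)) t).
{ intros A B f g Hf Hg.
  apply filterlim_locally; intros e.
  pose proof (proj1 (filterlim_locally _ _) Hf e) as H1.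
  pose proof (proj1 (filterlim_locally _ _) Hg e) as H2.
  generalize (filter_and _ _ H1 H2); apply filter_imp; intros s [? ?]; split; assumption. }
intros; unfold mk3.
apply pair_cont; apply pair_cont; try apply pair_cont; assumption.
Qed.

(** The angular momentum about the axis, corrected by a magnetic term. Its differential is minus the
    pairing of [omega r] with the infinitesimal rotation; the constant makes it vanish at the
    straight up top. *)
Definition momentum_map (r : R) (x : phase) : R :=
  c3 (cross (fst x) (snd x)) - r * (1 - c3 (fst x)).

Lemma TS2_lifted_rot theta x : TS2 x -> TS2 (lifted_rot theta x).
Proof.
destruct x as [[[q1 q2] q3] [[p1 p2] p3]].
unfold TS2, S2, lifted_rot, rot, dot, mk3, c1, c2, c3; simpl.
pose proof (sin2_cos2 theta) as H; unfold Rsqr in H.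
intros [H1 H2]; split; nsatz.
Qed.

Lemma hamiltonian_lifted_rot V theta x :
  SO2_invariant V -> TS2 x -> hamiltonian V (lifted_rot theta x) = hamiltonian V x.
Proof.
intros HV [Hq _]; unfold hamiltonian; simpl fst; rewrite (HV theta _ Hq).
f_equal; f_equal; destruct x as [q [[p1 p2] p3]].
unfold lifted_rot, rot, dot, mk3, c1, c2, c3; simpl.
pose proof (sin2_cos2 theta) as H; unfold Rsqr in H; nsatz.
Qed.

Lemma lifted_rot_0 x : lifted_rot 0 x = x.
Proof.
destruct x as [[[q1 q2] q3] [[p1 p2] p3]].
unfold lifted_rot, rot, mk3, c1, c2, c3; simpl; rewrite cos_0, sin_0.
repeat f_equal; ring.
Qed.

Definition rot_velocity (x : phase) : phase := (cross e3 (fst x), cross e3 (snd x)).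

Lemma is_derive_lifted_rot x theta :
  is_derive (fun s => lifted_rot s x) theta (rot_velocity (lifted_rot theta x)).
Proof.
destruct x as [[[q1 q2] q3] [[p1 p2] p3]].
unfold rot_velocity, cross, lifted_rot, rot, e3; cbn [mk3 fst snd c1 c2 c3].
apply is_derive_mk_phase; unfold mk3, c1, c2, c3; simpl; auto_derive; auto; ring.
Qed.

(* [is_differential] tests curves defined on all of [R], so the curve is stopped
   outside a neighborhood of [t]. *)
Lemma is_differential_along (h : phase -> R) (L : phase -> R) (g : R -> phase) a b (t : R) (v : phase) :
  Rbar_lt a t -> Rbar_lt t b ->
  (forall s : R, Rbar_lt a s -> Rbar_lt s b -> TS2 (g s)) ->
  is_derive g t v -> is_differential h (g t) L ->
  is_derive (fun s => h (g s)) t (L v).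
Proof.
intros Ha Hb HT Hg HL.
assert (Hloc : locally t (fun s : R => Rbar_lt a s /\ Rbar_lt s b)).
{ apply filter_and; [exact (open_Rbar_gt' (Finite t) a Ha) | exact (open_Rbar_lt' (Finite t) b Hb)]. }
destruct Hloc as [rho Hrho].
pose (c := fun s : R => if Rlt_dec (Rabs s) rho then g (t + s) else g t).
assert (Hin : forall s, Rabs s < rho -> Rbar_lt a (t + s) /\ Rbar_lt (t + s) b).
{ intros s Hs; apply Hrho; change (Rabs (t + s - t) < rho).
  replace (t + s - t) with s by ring; exact Hs. }
assert (Hceq : locally 0 (fun s => c s = g (t + s))).
{ exists rho; intros s Hs; change (Rabs (s - 0) < rho) in Hs.
  rewrite Rminus_0_r in Hs; unfold c; destruct Rlt_dec; [reflexivity | contradiction]. }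
assert (Hc0 : c 0 = g t).
{ unfold c; destruct Rlt_dec; [f_equal; ring | reflexivity]. }
assert (Hcd : is_derive c 0 v).
{ apply (is_derive_ext_loc (fun s => g (t + s))).
  { generalize Hceq; apply filter_imp; intros s Hs; symmetry; exact Hs. }
  rewrite <- (scal_one v).
  apply (is_derive_comp g (fun s => t + s)).
  - rewrite Rplus_0_r; exact Hg.
  - auto_derive; auto; ring. }
assert (HcT : forall s, TS2 (c s)).
{ intros s; unfold c; destruct Rlt_dec as [Hs|_]; apply HT; try assumption;
  destruct (Hin s Hs); assumption. }
pose proof (HL c v HcT Hc0 Hcd) as Hd.
assert (Hd' : is_derive (fun s => h (g (t + s))) 0 (L v)).
{ apply (is_derive_ext_loc (fun s => h (c s))); [|exact Hd].
  generalize Hceq; apply filter_imp; intros s Hs; rewrite Hs; reflexivity. }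
apply (is_derive_ext (fun s => h (g (t + (s - t))))).
{ intros s; do 2 f_equal; ring. }
rewrite <- (scal_one (L v)).
apply (is_derive_comp (fun s => h (g (t + s))) (fun s => s - t)).
- rewrite Rminus_diag; exact Hd'.
- auto_derive; auto; ring.
Qed.

Lemma omega_alternating r x xi : omega r x xi xi = 0.
Proof.
destruct x as [[[q1 q2] q3] p], xi as [[[a1 a2] a3] [[b1 b2] b3]].
unfold omega, omega_can, omega_S2, dot, cross, mk3, c1, c2, c3; simpl; ring.
Qed.

(** The rate of change of the energy is [omega r x xi xi], which vanishes because the form is
    alternating. *)
Lemma trajectory_hamiltonian r V a b g (t : R) :
  Rbar_lt a t -> Rbar_lt t b -> trajectory r V a b g ->
  is_derive (fun s => hamiltonian V (g s)) t 0.
Proof.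
intros Ha Hb Hg.
destruct (Hg t Ha Hb) as [_ [xi [[_ HL] Hd]]].
rewrite <- (omega_alternating r (g t) xi).
apply (is_differential_along _ (omega r (g t) xi) g a b); try assumption.
intros s Hs1 Hs2; apply (Hg s Hs1 Hs2).
Qed.

(* Noether: the derivative of the momentum is the symplectic pairing with the
   infinitesimal rotation, i.e. the derivative of the invariant Hamiltonian
   along the orbit. *)
Lemma trajectory_momentum_map r V a b g (t : R) :
  SO2_invariant V ->
  Rbar_lt a t -> Rbar_lt t b -> trajectory r V a b g ->
  is_derive (fun s => momentum_map r (g s)) t 0.
Proof.
intros HV Ha Hb Hg.
destruct (Hg t Ha Hb) as [HT [xi [[Htan HL] Hd]]].
assert (H0 : omega r (g t) xi (rot_velocity (g t)) = 0).
{ assert (Hh : is_derive (fun s => hamiltonian V (lifted_rot s (g t))) 0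
                 (omega r (g t) xi (rot_velocity (g t)))).
  { apply HL.
    - intros s; apply TS2_lifted_rot, HT.
    - apply lifted_rot_0.
    - pose proof (is_derive_lifted_rot (g t) 0) as Hrot.
      rewrite lifted_rot_0 in Hrot; exact Hrot. }
  apply is_derive_unique in Hh; rewrite <- Hh.
  apply is_derive_unique.
  apply (is_derive_ext (fun _ => hamiltonian V (g t))).
  - intros s; symmetry; apply hamiltonian_lifted_rot; assumption.
  - apply @is_derive_const. }
destruct (is_derive_phase g t xi Hd) as [[D1 [D2 D3]] [D4 [D5 D6]]].
destruct HT as [HS HO], Htan as [T1 T2].
apply (is_derive_ext (fun s => c1 (fst (g s)) * c2 (snd (g s))
     - c2 (fst (g s)) * c1 (snd (g s)) - r * (1 - c3 (fst (g s))))).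
{ intros s; reflexivity. }
evar_last; [derive_arith | cbv beta].
clear D1 D2 D3 D4 D5 D6 Hd HL Hg; revert H0 HS HO T1 T2.
destruct (g t) as [[[q1 q2] q3] [[p1 p2] p3]], xi as [[[a1 a2] a3] [[b1 b2] b3]].
unfold S2, omega, omega_can, omega_S2, rot_velocity, e3, dot, cross, mk3, c1, c2, c3; simpl.
intros; nsatz.
Qed.

(** * The neighborhood of a relative equilibrium *)

Lemma continuous_Rmult {T : UniformSpace} (f g : T -> R) x :
  continuous f x -> continuous g x -> continuous (fun y => f y * g y) x.
Proof. exact (continuous_mult (K := R_AbsRing) f g x). Qed.

Lemma continuous_Rplus {T : UniformSpace} (f g : T -> R) x :
  continuous f x -> continuous g x -> continuous (fun y => f y + g y) x.
Proof. exact (continuous_plus (V := R_NormedModule) f g x). Qed.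

Lemma continuous_Rminus {T : UniformSpace} (f g : T -> R) x :
  continuous f x -> continuous g x -> continuous (fun y => f y - g y) x.
Proof. exact (continuous_minus (V := R_NormedModule) f g x). Qed.

Ltac continuous_arith :=
  lazymatch goal with
  | |- continuous (fun s => @?f s * @?g s) _ => apply (continuous_Rmult f g); continuous_arith
  | |- continuous (fun s => @?f s + @?g s) _ => apply (continuous_Rplus f g); continuous_arith
  | |- continuous (fun s => @?f s - @?g s) _ => apply (continuous_Rminus f g); continuous_arith
  | |- continuous (fun _ => ?a) _ => exact (continuous_const a _)
  | |- _ => try eassumption
  end.

Lemma continuous_coordinates (x : phase) :
  (continuous (fun y : phase => c1 (fst y)) x /\
   continuous (fun y : phase => c2 (fst y)) x /\
   continuous (fun y : phase => c3 (fst y)) x) /\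
  (continuous (fun y : phase => c1 (snd y)) x /\
   continuous (fun y : phase => c2 (snd y)) x /\
   continuous (fun y : phase => c3 (snd y)) x).
Proof.
assert (Hball : forall (f : phase -> R), (forall e : posreal, forall y, ball x e y -> ball (f x) e (f y)) ->
  continuous f x).
{ intros f Hf; apply filterlim_locally; intros e; exists e; exact (Hf e). }
split; (split; [|split]); apply Hball; intros e y [[[? ?] ?] [[? ?] ?]]; assumption.
Qed.

Lemma ball_phase (x y : phase) (e : posreal) :
  Rabs (c1 (fst y) - c1 (fst x)) < e -> Rabs (c2 (fst y) - c2 (fst x)) < e ->
  Rabs (c3 (fst y) - c3 (fst x)) < e ->
  Rabs (c1 (snd y) - c1 (snd x)) < e -> Rabs (c2 (snd y) - c2 (snd x)) < e ->
  Rabs (c3 (snd y) - c3 (snd x)) < e -> ball x e y.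
Proof. intros; repeat split; assumption. Qed.

Lemma S2_c3_bound q : S2 q -> -1 <= c3 q <= 1.
Proof. unfold S2, dot; intros H; split; nra. Qed.

Lemma polar_angle x y : exists theta,
  x = sqrt (x ^ 2 + y ^ 2) * cos theta /\ y = sqrt (x ^ 2 + y ^ 2) * sin theta.
Proof.
set (u := sqrt (x ^ 2 + y ^ 2)).
assert (Hu2 : u * u = x ^ 2 + y ^ 2) by (apply sqrt_sqrt; nra).
destruct (Req_dec u 0) as [Hu|Hu].
{ exists 0; rewrite Hu; rewrite Hu in Hu2; split; nra. }
assert (0 < u) by (pose proof (sqrt_pos (x ^ 2 + y ^ 2)); fold u in H; lra).
assert (Hxu : -1 <= x / u <= 1).
{ split; [apply Rle_div_r | apply Rle_div_l]; try assumption; nra. }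
assert (Hs : sin (acos (x / u)) = Rabs y / u).
{ rewrite sin_acos by exact Hxu.
  apply sqrt_lem_1.
  - unfold Rsqr; nra.
  - apply Rdiv_le_0_compat; [apply Rabs_pos | assumption].
  - replace (Rabs y / u * (Rabs y / u)) with (Rsqr (Rabs y) / (u * u))
      by (unfold Rsqr; field; assumption).
    rewrite <- Rsqr_abs; unfold Rsqr.
    replace (y * y) with (u * u - x * x) by nra; field; assumption. }
(* [acos] only takes values in the upper half circle, so the sign of [y] selects the sign of the
   angle. *)
destruct (Rle_dec 0 y) as [Hy|Hy].
- exists (acos (x / u)); rewrite Hs, cos_acos, Rabs_pos_eq by assumption.
  split; field; assumption.
- exists (- acos (x / u)); rewrite cos_neg, sin_neg, Hs, cos_acos by assumption.
  rewrite Rabs_left by lra; split; field; assumption.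
Qed.

Lemma rotated_from_meridian q : S2 q -> 0 <= c3 q ->
  exists theta, q = rot theta (meridian_point (sqrt (1 - c3 q ^ 2))).
Proof.
destruct q as [[x y] z]; unfold S2, dot, c1, c2, c3; simpl; intros HS Hz.
destruct (polar_angle x y) as [theta [Hx Hy]]; exists theta.
unfold meridian_point, rot, mk3, c1, c2, c3; simpl.
replace (x ^ 2 + y ^ 2) with (1 - z * (z * 1)) in Hx, Hy by nra.
assert (Hsq : sqrt (1 - z * (z * 1)) * sqrt (1 - z * (z * 1)) = 1 - z * (z * 1))
  by (apply sqrt_sqrt; nra).
f_equal; [f_equal|]; [lra | lra |].
rewrite <- (sqrt_Rsqr z Hz) at 1; f_equal; unfold Rsqr; nra.
Qed.

(** The meridian meets every orbit of the upper hemisphere, so invariance carries the defining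
    relation of [W] over to the whole cap. *)
Lemma invariant_on_cap V W q :
  SO2_invariant V -> (forall u, 0 <= u < 1 -> W (u ^ 2) = V (meridian_point u)) ->
  S2 q -> 0 < c3 q -> V q = W (1 - c3 q ^ 2).
Proof.
intros HV HW Hq Hz.
pose proof (S2_c3_bound q Hq).
destruct (rotated_from_meridian q Hq (Rlt_le _ _ Hz)) as [theta Ht].
assert (Hu2 : sqrt (1 - c3 q ^ 2) ^ 2 = 1 - c3 q ^ 2) by (apply pow2_sqrt; nra).
assert (Hu : 0 <= sqrt (1 - c3 q ^ 2) < 1).
{ split; [apply sqrt_pos|].
  rewrite <- sqrt_1 at 2; apply sqrt_lt_1_alt; nra. }
set (u := sqrt (1 - c3 q ^ 2)) in *.
rewrite <- Hu2, HW by assumption.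
rewrite Ht; apply HV.
unfold S2, dot, meridian_point, mk3, c1, c2, c3; simpl.
rewrite sqrt_sqrt by nra; ring.
Qed.

(** The state of rigid rotation about the axis with angular velocity [Om], that is
    [p = Om e3 x q]. *)
Definition re_point (u Om : R) : phase := (meridian_point u, mk3 0 (Om * u) 0).

(** The effective potential in the frame rotating with angular velocity [Om]: centrifugal term,
    magnetic term and potential. *)
Definition aug (l : R -> R) (r Om z : R) : R :=
  - / 2 * Om ^ 2 * (1 - z ^ 2) + Om * r * (1 - z) + l (1 - z ^ 2).

(* [|p - Om e3 x q|^2] *)
Definition slip (Om : R) (x : phase) : R :=
  (c1 (snd x) + Om * c2 (fst x)) * (c1 (snd x) + Om * c2 (fst x))
  + (c2 (snd x) - Om * c1 (fst x)) * (c2 (snd x) - Om * c1 (fst x))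
  + c3 (snd x) * c3 (snd x).

Lemma slip_lifted_rot Om theta x : slip Om (lifted_rot theta x) = slip Om x.
Proof.
destruct x as [[[q1 q2] q3] [[p1 p2] p3]].
unfold slip, lifted_rot, rot, mk3, c1, c2, c3; simpl.
pose proof (sin2_cos2 theta) as H; unfold Rsqr in H; nsatz.
Qed.

Lemma slip_nonneg Om x : 0 <= slip Om x.
Proof. unfold slip; repeat apply Rplus_le_le_0_compat; apply Rle_0_sqr. Qed.

Lemma energy_momentum V l r Om x :
  (forall q, S2 q -> 0 < c3 q -> V q = l (1 - c3 q ^ 2)) ->
  TS2 x -> 0 < c3 (fst x) ->
  hamiltonian V x - Om * momentum_map r x = / 2 * slip Om x + aug l r Om (c3 (fst x)).
Proof.
intros Hcap [HS _] Hz; unfold hamiltonian, aug; rewrite (Hcap _ HS Hz).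
destruct x as [[[q1 q2] q3] [[p1 p2] p3]].
revert HS; unfold S2, momentum_map, slip, dot, cross, mk3, c1, c2, c3; simpl; intros HS.
assert (E : / 2 * Om ^ 2 * (1 - q3 * q3) = / 2 * Om ^ 2 * (q1 * q1 + q2 * q2))
  by (rewrite <- HS; ring).
set (L := l _); clearbody L; lra.
Qed.

(** The barrier argument behind Lyapunov stability, from the intermediate value theorem. *)
Lemma no_crossing (f : R -> R) c t :
  0 <= t -> (forall s, 0 <= s <= t -> continuous f s) -> f 0 < c ->
  (forall s, 0 <= s <= t -> f s <> c) -> f t < c.
Proof.
intros Ht Hf H0 Hne.
destruct (Rlt_dec (f t) c) as [|Hn]; [assumption|exfalso].
assert (Hgt : c < f t) by (pose proof (Hne t ltac:(lra)); lra).
destruct (Rle_lt_or_eq_dec 0 t Ht) as [Ht'|<-]; [|lra].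
destruct (Ranalysis5.IVT_interv (fun s => f s - c) 0 t) as [s [Hs Hs0]]; try lra.
- intros s Hs; apply continuity_pt_filterlim; apply (continuous_Rminus f (fun _ => c)).
  + apply Hf, Hs.
  + apply continuous_const.
- apply (Hne s Hs); lra.
Qed.

Lemma conserved_along (f : R -> R) (a b : Rbar) (t : R) :
  Rbar_lt a 0 -> 0 <= t -> Rbar_lt t b ->
  (forall s : R, Rbar_lt a s -> Rbar_lt s b -> is_derive f s 0) -> f t = f 0.
Proof.
intros Ha Ht Hb Hf.
destruct (Rle_lt_or_eq_dec 0 t Ht) as [Ht'|<-]; [|reflexivity].
symmetry; apply (eq_is_derive (V := R_NormedModule) f 0 t); [|assumption].
intros s Hs; apply Hf.
- apply (Rbar_lt_le_trans _ 0); [assumption | apply Hs].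
- apply (Rbar_le_lt_trans _ t); [apply Hs | assumption].
Qed.

Lemma meridian_height u : 0 <= u < 1 -> 0 < sqrt (1 - u ^ 2) <= 1.
Proof.
intros Hu; split.
- apply sqrt_lt_R0; nra.
- rewrite <- sqrt_1 at 2; apply sqrt_le_1_alt; nra.
Qed.

Lemma slip_re_point u Om : slip Om (re_point u Om) = 0.
Proof.
unfold slip, re_point, meridian_point, mk3, c1, c2, c3; simpl; ring.
Qed.

(** Height and slip are rotation invariant, and together they control the distance to the orbit.
    After a rotation onto the meridian, the height determines [q] continuously, and a small slip
    forces [p] to be close to [Om e3 x q]. *)
Lemma invariant_neighborhood_re_point U u Om :
  0 <= u < 1 -> invariant_set U -> orbit_neighborhood (re_point u Om) U ->
  exists eta, 0 < eta /\ forall y, TS2 y -> 0 < c3 (fst y) ->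
    Rabs (c3 (fst y) - sqrt (1 - u ^ 2)) < eta -> slip Om y < eta -> U y.
Proof.
intros Hu HI HU.
pose proof (meridian_height u Hu) as Hz.
destruct (HU (re_point u Om)) as [rho Hrho].
{ exists 0; symmetry; apply lifted_rot_0. }
pose proof (cond_pos rho) as Hrp.
assert (Hk : continuous (fun z => sqrt (1 - z ^ 2)) (sqrt (1 - u ^ 2))).
{ apply continuous_comp.
  - apply (ex_derive_continuous (fun z => 1 - z ^ 2)); auto_derive; auto.
  - apply continuous_sqrt. }
assert (Hku : sqrt (1 - sqrt (1 - u ^ 2) ^ 2) = u).
{ rewrite pow2_sqrt by nra; replace (1 - (1 - u ^ 2)) with (Rsqr u) by (unfold Rsqr; ring).
  apply sqrt_Rsqr; lra. }
pose proof (Rabs_pos Om).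
assert (Hd : 0 < Rmin rho (rho / (2 * (Rabs Om + 1)))).
{ apply Rmin_glb_lt; [assumption | apply Rdiv_lt_0_compat; lra]. }
destruct (proj1 (filterlim_locally _ _) Hk (mkposreal _ Hd)) as [eta1 He1].
pose proof (cond_pos eta1).
(* A slip below [rho ^ 2 / 4] keeps each component of [p - Om e3 x q] below [rho / 2]; the other
   half of [rho] absorbs the error [Om * (u0 - u)] in the second momentum component. *)
exists (Rmin (Rmin eta1 rho) (rho ^ 2 / 4)); split.
{ repeat apply Rmin_glb_lt; try assumption; nra. }
intros y HT Hy Hyz Hys.
assert (Hz1 : Rabs (c3 (fst y) - sqrt (1 - u ^ 2)) < eta1).
{ eapply Rlt_le_trans; [exact Hyz|]; eapply Rle_trans; [apply Rmin_l|apply Rmin_l]. }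
assert (Hz2 : Rabs (c3 (fst y) - sqrt (1 - u ^ 2)) < rho).
{ eapply Rlt_le_trans; [exact Hyz|]; eapply Rle_trans; [apply Rmin_l|apply Rmin_r]. }
assert (Hs : slip Om y < rho ^ 2 / 4).
{ eapply Rlt_le_trans; [exact Hys|]; apply Rmin_r. }
destruct (rotated_from_meridian (fst y) (proj1 HT)) as [theta Ht]; [lra|].
set (u0 := sqrt (1 - c3 (fst y) ^ 2)) in *.
assert (Hu0 : Rabs (u0 - u) < Rmin rho (rho / (2 * (Rabs Om + 1)))).
{ pose proof (He1 (c3 (fst y)) Hz1) as Hb; rewrite Hku in Hb; exact Hb. }
assert (Hu1 : Rabs (u0 - u) < rho) by (eapply Rlt_le_trans; [exact Hu0|apply Rmin_l]).
assert (Hu2 : Rabs Om * Rabs (u0 - u) <= rho / 2).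
{ assert (Hb : Rabs (u0 - u) < rho / (2 * (Rabs Om + 1)))
    by (eapply Rlt_le_trans; [exact Hu0|apply Rmin_r]).
  apply Rlt_div_r in Hb; [|lra].
  pose proof (Rabs_pos (u0 - u)); nra. }
pose (y0 := lifted_rot (- theta) y).
assert (Hy0 : y = lifted_rot theta y0).
{ unfold y0; destruct y as [[[a1 a2] a3] [[b1 b2] b3]].
  unfold lifted_rot, rot, mk3, c1, c2, c3; simpl; rewrite cos_neg, sin_neg.
  pose proof (sin2_cos2 theta) as Hsc; unfold Rsqr in Hsc.
  repeat f_equal; nsatz. }
assert (HT0 : TS2 y0) by apply TS2_lifted_rot, HT.
assert (Hq0 : fst y0 = mk3 u0 0 (c3 (fst y))).
{ unfold y0, lifted_rot; cbn [fst].
  assert (Hc : c3 (fst y) = sqrt (1 - u0 ^ 2)).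
  { rewrite Ht; unfold rot, meridian_point, mk3, c3; simpl; reflexivity. }
  rewrite Hc, Ht.
  unfold rot, meridian_point, mk3, c1, c2, c3; simpl; rewrite cos_neg, sin_neg.
  pose proof (sin2_cos2 theta) as Hsc; unfold Rsqr in Hsc.
  f_equal; f_equal; nsatz. }
assert (Hs0 : slip Om y0 < rho ^ 2 / 4) by (unfold y0; rewrite slip_lifted_rot; exact Hs).
rewrite Hy0; apply HI; [exact HT0|].
apply Hrho; [|exact HT0].
clearbody y0 u0.
destruct y0 as [q0 [[b1 b2] b3]]; simpl in Hq0; subst q0.
revert Hs0; unfold slip.
unfold mk3, c1, c2; simpl.
set (w1 := b1 + Om * 0); set (w2 := b2 - Om * u0); intros Hs0.
change (snd (b1, b2, b3)) with b3 in Hs0; unfold c3 in Hs0; simpl in Hs0.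
apply ball_phase; unfold re_point, meridian_point, mk3, c1, c2, c3; simpl.
- exact Hu1.
- rewrite Rminus_0_r, Rabs_R0; assumption.
- exact Hz2.
- apply Rabs_def1; unfold w1 in *; nra.
- replace (b2 - Om * u) with (w2 + Om * (u0 - u)) by (unfold w2; ring).
  eapply Rle_lt_trans; [apply Rabs_triang|]; rewrite Rabs_mult.
  assert (Rabs w2 < rho / 2) by (apply Rabs_def1; nra); lra.
- apply Rabs_def1; nra.
Qed.

(** * The Lyapunov function and spherical coordinates *)

(* Instance search does not unfold [phase] to a product. *)
#[local] Instance phase_locally_filter (y : phase) : @Filter phase (locally y).
Proof. exact (filter_filter (ProperFilter := locally_filter (T := prod_UniformSpace _ _) y)). Qed.

(** A trajectory starting with [/ 2 * slip + A z] below the values of [A] at the edges of a window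
    around the minimum cannot leave the window, and the excess over the minimum bounds the slip.
    Only heights [z <= 1] are tested, so at the pole a one-sided minimum suffices. *)
Lemma G_stable_of_strict_min r V l Om u eps :
  SO2_invariant V -> (forall q, S2 q -> 0 < c3 q -> V q = l (1 - c3 q ^ 2)) ->
  0 <= u < 1 -> 0 < eps ->
  continuous (aug l r Om) (sqrt (1 - u ^ 2)) ->
  (forall z, Rabs (z - sqrt (1 - u ^ 2)) < eps -> z <= 1 -> z <> sqrt (1 - u ^ 2) ->
     aug l r Om (sqrt (1 - u ^ 2)) < aug l r Om z) ->
  G_stable r V (re_point u Om).
Proof.
intros HV Hcap Hu Heps HAc Hmin U HI HU.
destruct (invariant_neighborhood_re_point U u Om Hu HI HU) as [eta [Heta HUeta]].
pose proof (meridian_height u Hu) as Hz.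
set (zs := sqrt (1 - u ^ 2)) in *.
set (A := aug l r Om) in *.
assert (He : exists e, 0 < e /\ e < eps /\ e < eta /\ e < zs).
{ exists (Rmin (Rmin eps eta) zs / 2).
  pose proof (Rmin_l (Rmin eps eta) zs); pose proof (Rmin_r (Rmin eps eta) zs).
  pose proof (Rmin_l eps eta); pose proof (Rmin_r eps eta).
  assert (0 < Rmin (Rmin eps eta) zs) by (repeat apply Rmin_glb_lt; lra).
  repeat split; lra. }
destruct He as [e [He0 [He1 [He2 He3]]]].
assert (Hm : exists m, 0 < m /\ m <= eta / 2 /\
  forall z, Rabs (z - zs) = e -> z <= 1 -> A zs + m <= A z).
{ assert (Habs : forall s, s = e \/ s = - e -> Rabs (zs + s - zs) = e).
  { intros s Hs; replace (zs + s - zs) with s by ring.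
    destruct Hs as [-> | ->]; [|rewrite Rabs_Ropp]; apply Rabs_pos_eq; lra. }
  assert (Hlow : 0 < A (zs - e) - A zs).
  { apply Rlt_0_minus, Hmin; [|lra|lra]; unfold Rminus at 2; rewrite Habs by tauto; lra. }
  (* The bound [eta / 2] will keep the slip below [eta]. The upper edge [zs + e] counts only if the
     sphere reaches that height; the value 1 is a placeholder otherwise. *)
  exists (Rmin (eta / 2) (Rmin (A (zs - e) - A zs)
     (if Rle_dec (zs + e) 1 then A (zs + e) - A zs else 1))).
  split; [|split].
  - repeat apply Rmin_glb_lt; try lra.
    destruct (Rle_dec (zs + e) 1) as [Hle|]; [|lra].
    apply Rlt_0_minus, Hmin; [|lra|lra]; rewrite Habs by tauto; lra.
  - apply Rmin_l.
  - intros z Hze Hz1.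
    destruct (Rle_dec zs z) as [Hzz|Hzz].
    + rewrite Rabs_pos_eq in Hze by lra.
      assert (z = zs + e) as -> by lra.
      eapply Rle_trans; [apply Rplus_le_compat_l; eapply Rle_trans; apply Rmin_r|].
      destruct (Rle_dec (zs + e) 1); lra.
    + rewrite Rabs_left in Hze by lra.
      assert (z = zs - e) as -> by lra.
      eapply Rle_trans; [apply Rplus_le_compat_l; eapply Rle_trans;
        [apply Rmin_r | apply Rmin_l] |]; lra. }
destruct Hm as [m [Hm0 [Hm1 Hm2]]].
pose (L := fun x : phase => / 2 * slip Om x + A (c3 (fst x))).
exists (fun x : phase => Rabs (c3 (fst x) - zs) < e /\ L x < A zs + m); split.
- intros y [theta ->].
  set (y := lifted_rot theta (re_point u Om)).
  assert (Hyz : c3 (fst y) = zs) by reflexivity.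
  assert (Hys : slip Om y = 0) by (unfold y; rewrite slip_lifted_rot; apply slip_re_point).
  destruct (continuous_coordinates y) as [[C1 [C2 C3]] [C4 [C5 C6]]].
  assert (HLc : continuous L y).
  { unfold L, slip.
    assert (HAy : continuous (fun x : phase => A (c3 (fst x))) y)
      by (apply (continuous_comp (fun x : phase => c3 (fst x)) A y C3); exact HAc).
    continuous_arith. }
  unfold within; apply (filter_imp (fun x : phase => Rabs (c3 (fst x) - zs) < e /\ L x < A zs + m));
    [intros x Hx _; exact Hx|].
  apply filter_and.
  + apply (C3 (fun v => Rabs (v - zs) < e)); rewrite Hyz.
    exists (mkposreal e He0); intros v Hv; exact Hv.
  + apply (HLc (fun v => v < A zs + m)).
    apply (open_lt (A zs + m)); unfold L; rewrite Hys, Hyz; lra.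
- intros a b g Ha Hb Hg [Hg1 Hg2] t Ht Htb.
  assert (Hin : forall s, 0 <= s <= t -> Rbar_lt a s /\ Rbar_lt s b).
  { intros s Hs; split.
    - apply (Rbar_lt_le_trans _ 0); [assumption | apply Hs].
    - apply (Rbar_le_lt_trans _ t); [apply Hs | assumption]. }
  assert (HT : forall s, 0 <= s <= t -> TS2 (g s)).
  { intros s Hs; destruct (Hin s Hs) as [? ?]; apply (Hg s); assumption. }
  assert (Hcons : forall s, 0 <= s <= t ->
    hamiltonian V (g s) - Om * momentum_map r (g s)
    = hamiltonian V (g 0) - Om * momentum_map r (g 0)).
  { intros s Hs; destruct (Hin s Hs) as [_ Hsb].
    rewrite (conserved_along (fun s => hamiltonian V (g s)) a b s);
      [rewrite (conserved_along (fun s => momentum_map r (g s)) a b s); [reflexivity|..]|..];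
      try assumption; try apply Hs.
    - intros w Hw1 Hw2; apply (trajectory_momentum_map r V a b); assumption.
    - intros w Hw1 Hw2; apply (trajectory_hamiltonian r V a b); assumption. }
  (* [L] equals the conserved quantity [h - Om J] only on the upper hemisphere, where [V] is
     expressed by [l]. *)
  assert (HL : forall s, 0 <= s <= t -> 0 < c3 (fst (g s)) -> L (g s) < A zs + m).
  { intros s Hs Hz3; unfold L, A.
    rewrite <- (energy_momentum V) by auto.
    rewrite Hcons by assumption.
    rewrite (energy_momentum V l); [exact Hg2 | assumption | apply HT; lra |].
    apply Rabs_def2 in Hg1; lra. }
  assert (Hzc : forall s, 0 <= s <= t -> continuous (fun s => c3 (fst (g s))) s).
  { intros s Hs; destruct (Hin s Hs) as [Hs1 Hs2].
    destruct (Hg s Hs1 Hs2) as [_ [xi [_ Hd]]].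
    apply (ex_derive_continuous (K := R_AbsRing) (V := R_NormedModule)).
    destruct (is_derive_phase g s xi Hd) as [[_ [_ D3]] _]; eexists; exact D3. }
  assert (Hconf : forall s, 0 <= s <= t -> Rabs (c3 (fst (g s)) - zs) < e).
  { intros s Hs.
    apply (no_crossing (fun s => Rabs (c3 (fst (g s)) - zs))); [apply Hs | | assumption |].
    - intros w Hw.
      apply (continuous_comp (fun s => c3 (fst (g s)) - zs) Rabs).
      + apply (continuous_Rminus (fun s => c3 (fst (g s))) (fun _ => zs)).
        * apply Hzc; lra.
        * apply continuous_const.
      + apply continuous_Rabs.
    - intros w Hw Hwe.
      assert (Hwt : 0 <= w <= t) by lra.
      assert (Hwz : 0 < c3 (fst (g w))).
      { assert (Rabs (c3 (fst (g w)) - zs) < zs) as Hlt by lra.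
        apply Rabs_def2 in Hlt; lra. }
      pose proof (HL w Hwt Hwz) as H1; unfold L in H1.
      pose proof (slip_nonneg Om (g w)).
      pose proof (S2_c3_bound _ (proj1 (HT w Hwt))).
      pose proof (Hm2 _ Hwe ltac:(lra)); lra. }
  assert (Htt : 0 <= t <= t) by lra.
  pose proof (Hconf t Htt) as Hct.
  assert (Hpos : 0 < c3 (fst (g t))) by (apply Rabs_def2 in Hct; lra).
  apply HUeta; [apply HT, Htt | assumption | lra |].
  pose proof (HL t Htt Hpos) as H1; unfold L in H1.
  pose proof (S2_c3_bound _ (proj1 (HT t Htt))).
  destruct (Req_dec (c3 (fst (g t))) zs) as [Heq|Hne].
  + rewrite Heq in H1; lra.
  + assert (A zs < A (c3 (fst (g t)))) by (apply Hmin; try assumption; lra); lra.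
Qed.

(* Spherical coordinates: colatitude [th], longitude [ph], and their
   velocities [dth] and [dph]. *)
Definition spherical (th ph dth dph : R) : phase :=
  (mk3 (sin th * cos ph) (sin th * sin ph) (cos th),
   mk3 (cos th * dth * cos ph - sin th * dph * sin ph)
       (cos th * dth * sin ph + sin th * dph * cos ph)
       (- sin th * dth)).

(** [er] and [ep] are the radial and azimuthal components of the horizontal acceleration in
    cylindrical coordinates. *)
Definition spherical_velocity (th ph dth dph ddth ddph : R) : phase :=
  let er := cos th * ddth - sin th * (dth ^ 2 + dph ^ 2) in
  let ep := 2 * cos th * dth * dph + sin th * ddph in
  (snd (spherical th ph dth dph),
   mk3 (er * cos ph - ep * sin ph) (er * sin ph + ep * cos ph)
       (- cos th * dth ^ 2 - sin th * ddth)).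

Lemma is_derive_spherical (th ph dth dph : R -> R) t ddth ddph :
  is_derive th t (dth t) -> is_derive ph t (dph t) ->
  is_derive dth t ddth -> is_derive dph t ddph ->
  is_derive (fun s => spherical (th s) (ph s) (dth s) (dph s)) t
    (spherical_velocity (th t) (ph t) (dth t) (dph t) ddth ddph).
Proof.
intros H1 H2 H3 H4.
assert (Hs := is_derive_Rcomp sin th t _ _ (is_derive_sin _) H1).
assert (Hc := is_derive_Rcomp cos th t _ _ (is_derive_cos _) H1).
assert (Hsp := is_derive_Rcomp sin ph t _ _ (is_derive_sin _) H2).
assert (Hcp := is_derive_Rcomp cos ph t _ _ (is_derive_cos _) H2).
assert (Hms : is_derive (fun s => - sin (th s)) t (- (dth t * cos (th t)))).
{ apply (is_derive_opp (K := R_AbsRing) (V := R_NormedModule)); exact Hs. }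
unfold spherical, spherical_velocity; cbn [snd fst].
apply is_derive_mk_phase; (evar_last; [derive_arith | cbv beta; ring]).
Qed.

Lemma TS2_spherical th ph dth dph : TS2 (spherical th ph dth dph).
Proof.
pose proof (sin2_cos2 th) as H1; pose proof (sin2_cos2 ph) as H2.
unfold Rsqr in *; unfold TS2, S2, spherical, dot, mk3, c1, c2, c3; simpl.
split; nsatz.
Qed.

(** The last two hypotheses are the equations of motion in spherical coordinates, including the
    magnetic force. The second is not solved for [ddph], so the pole [sin th = 0] is covered. *)
Lemma is_hamiltonian_vector_spherical r V l l1 th ph dth dph ddth ddph :
  (forall q, S2 q -> 0 < c3 q -> V q = l (1 - c3 q ^ 2)) ->
  0 < cos th -> is_derive l (1 - cos th ^ 2) l1 ->
  ddth = sin th * cos th * dph ^ 2 - r * sin th * dph - 2 * l1 * sin th * cos th ->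
  sin th * ddph = r * dth - 2 * cos th * dth * dph ->
  is_hamiltonian_vector r (hamiltonian V) (spherical th ph dth dph)
    (spherical_velocity th ph dth dph ddth ddph).
Proof.
intros Hcap Hz Hl E1 E2.
pose proof (sin2_cos2 th) as T1; pose proof (sin2_cos2 ph) as T2; unfold Rsqr in *.
split.
{ unfold tangent, spherical, spherical_velocity, dot, mk3, c1, c2, c3; simpl.
  split; nsatz. }
intros c v Hc Hc0 Hd.
destruct (is_derive_phase c 0 v Hd) as [[D1 [D2 D3]] [D4 [D5 D6]]].
(* The test curve stays on the sphere, so differentiating [dot q q = 1] makes its velocity
   tangent. *)
assert (Hq : dot (fst (c 0)) (fst v) = 0).
{ assert (Hdot : is_derive (fun s => dot (fst (c s)) (fst (c s))) 0
     (2 * dot (fst (c 0)) (fst v))).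
  { unfold dot; evar_last; [derive_arith | cbv beta; ring]. }
  assert (H0 : is_derive (fun s => dot (fst (c s)) (fst (c s))) 0 0).
  { apply (is_derive_ext (fun _ => 1)).
    - intros s; symmetry; apply (Hc s).
    - apply is_derive_Rconst. }
  apply is_derive_unique in Hdot; apply is_derive_unique in H0; lra. }
assert (Hpos : locally 0 (fun s => 0 < c3 (fst (c s)))).
{ assert (Hcont : continuous (fun s => c3 (fst (c s))) 0)
    by (apply (ex_derive_continuous (K := R_AbsRing) (V := R_NormedModule)); eexists; exact D3).
  apply (Hcont (fun x => 0 < x)), (open_gt 0); rewrite Hc0; exact Hz. }
apply (is_derive_ext_loc (fun s => / 2 * dot (snd (c s)) (snd (c s)) + l (1 - c3 (fst (c s)) ^ 2))).
{ generalize Hpos; apply filter_imp; intros s Hs; unfold hamiltonian.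
  rewrite (Hcap _ (proj1 (Hc s)) Hs); reflexivity. }
assert (Hin : is_derive (fun s => 1 - c3 (fst (c s)) ^ 2) 0
   (- 2 * c3 (fst (c 0)) * c3 (fst v))).
{ apply (is_derive_ext (fun s => 1 - c3 (fst (c s)) * c3 (fst (c s)))).
  { intros s; simpl; rewrite Rmult_1_r; reflexivity. }
  evar_last; [derive_arith | cbv beta; ring]. }
assert (Hl' : is_derive l (1 - c3 (fst (c 0)) ^ 2) l1) by (rewrite Hc0; exact Hl).
pose proof (is_derive_Rcomp l _ 0 _ _ Hl' Hin) as HlV.
unfold dot at 1; evar_last; [derive_arith | cbv beta].
transitivity (dot (snd (c 0)) (snd v) - 2 * c3 (fst (c 0)) * c3 (fst v) * l1).
{ unfold dot; field. }
rewrite Hc0 in *; clear - Hq T1 T2 E1 E2.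
destruct v as [[[v1 v2] v3] [[w1 w2] w3]].
revert Hq; unfold omega, omega_can, omega_S2, spherical_velocity, spherical,
  dot, cross, mk3, c1, c2, c3; simpl.
set (s := sin th) in *; set (k := cos th) in *; set (sp := sin ph) in *; set (kp := cos ph) in *.
clearbody s k sp kp; intros Hq; subst ddth.
(* Tangent vectors at the point are combinations of the unit vectors along the
   meridian and along the parallel. *)
pose (b := - v1 * sp + v2 * kp); pose (a := (v1 * kp + v2 * sp) * k - v3 * s).
assert (V3 : v3 = - s * a) by (unfold a; nsatz).
assert (V1 : v1 = a * k * kp - b * sp) by (unfold a, b; nsatz).
assert (V2 : v2 = a * k * sp + b * kp) by (unfold a, b; nsatz).
clearbody a b; subst v1 v2 v3; clear Hq.
assert (Hk : k * k = 1 - s * s) by lra; assert (Hkp : kp * kp = 1 - sp * sp) by lra.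
ring [Hk Hkp E2].
Qed.

(** * Autonomous scalar equations and relative equilibria *)

Lemma mean_value (f df : R -> R) a b :
  a <= b -> (forall x, a <= x <= b -> is_derive f x (df x)) ->
  exists c, a <= c <= b /\ f b - f a = df c * (b - a).
Proof.
intros Hab Hd.
destruct (MVT_gen f a b df) as [c Hc]; rewrite ?Rmin_left, ?Rmax_right by assumption.
- intros x Hx; apply Hd; lra.
- intros x Hx; apply continuity_pt_filterlim.
  apply (ex_derive_continuous (K := R_AbsRing) (V := R_NormedModule)); eexists; apply Hd, Hx.
- rewrite Rmin_left, Rmax_right in Hc by assumption; exists c; exact Hc.
Qed.

(** Separation of variables: the elapsed time [T], the integral of [/ g], is an increasing bijection
    of the line, and the solution is its inverse. *)
Lemma autonomous_ode (g : R -> R) m M x0 :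
  (forall x, continuous g x) -> 0 < m -> (forall x, m <= g x <= M) ->
  exists S : R -> R, S 0 = x0 /\ forall t, is_derive S t (g (S t)).
Proof.
intros Hg Hm Hb.
assert (HM : 0 < M) by (destruct (Hb 0); lra).
assert (Hpos : forall x, 0 < g x) by (intros x; destruct (Hb x); lra).
pose (T := (fun x => RInt (fun y => / g y) x0 x) : R -> R).
assert (Hic : forall x, continuous (fun y => / g y) x).
{ intros x; apply continuous_Rinv_comp; [apply Hg | pose proof (Hpos x); lra]. }
assert (HT : forall x, is_derive T x (/ g x)).
{ intros x; apply (is_derive_RInt (V := R_NormedModule) (fun y => / g y) T x0 x).
  - apply filter_forall; intros y; apply (RInt_correct (V := R_CompleteNormedModule)).
    apply (ex_RInt_continuous (V := R_CompleteNormedModule)); intros z _; apply Hic.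
  - apply Hic. }
assert (HTx0 : T x0 = 0) by exact (RInt_point (V := R_CompleteNormedModule) x0 _).
assert (Hslope : forall x y, x <= y -> exists c, x <= c <= y /\ y - x = g c * (T y - T x)).
{ intros x y Hxy.
  destruct (mean_value T (fun z => / g z) x y Hxy (fun z _ => HT z)) as [c [Hc He]].
  exists c; split; [exact Hc|]; rewrite He; pose proof (Hpos c); field; lra. }
assert (Hincr : forall x y, x < y -> T x < T y).
{ intros x y Hxy; destruct (Hslope x y) as [c [_ Hc]]; [lra|]; pose proof (Hpos c); nra. }
assert (Hex : forall t, exists ! x, T x = t).
{ intros t.
  (* The slope of [T] is at least [/ M], so these points bracket a preimage of [t]. *)
  pose (a := x0 - M * Rabs t); pose (b := x0 + M * Rabs t).
  pose proof (Rabs_pos t) as Ht.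
  assert (Ha : T a <= - Rabs t).
  { destruct (Hslope a x0) as [c [_ Hc]]; [unfold a; nra|].
    rewrite HTx0 in Hc; unfold a in Hc at 1; destruct (Hb c); nra. }
  assert (Hb' : Rabs t <= T b).
  { destruct (Hslope x0 b) as [c [_ Hc]]; [unfold b; nra|].
    rewrite HTx0 in Hc; unfold b in Hc at 1; destruct (Hb c); nra. }
  destruct (IVT_gen T a b t) as [x [_ Hx]].
  - intros x; apply continuity_pt_filterlim.
    apply (ex_derive_continuous (K := R_AbsRing) (V := R_NormedModule)); eexists; apply HT.
  - pose proof (Rle_abs t); pose proof (Rle_abs (- t)) as Hn; rewrite Rabs_Ropp in Hn.
    rewrite Rmin_left, Rmax_right by lra; lra.
  - exists x; split; [exact Hx|]; intros y Hy.
    destruct (Rtotal_order x y) as [H|[H|H]]; [|exact H|];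
      apply Hincr in H; lra. }
pose (S := fun t => iota (fun x => T x = t)).
assert (HS : forall t, T (S t) = t).
{ intros t; apply (iota_correct (V := R_CompleteNormedModule) (fun x => T x = t)), Hex. }
assert (HSx : forall x, S (T x) = x).
{ intros x; destruct (Hex (T x)) as [y [Hy Hu]].
  rewrite <- (Hu (S (T x)) (HS _)); apply Hu; reflexivity. }
exists S; split; [rewrite <- HTx0; apply HSx|].
intros t; apply is_derive_Reals; intros eps Heps.
destruct (proj1 (filterlim_locally _ _) (Hg (S t)) (mkposreal eps Heps)) as [d Hd].
assert (Hdel : 0 < d / M) by (apply Rdiv_lt_0_compat; [apply cond_pos | assumption]).
exists (mkposreal _ Hdel); intros h Hh Hhd; simpl in Hhd.
(* The difference quotient of [S] is a value of [g] between [S t] and [S (t + h)]. Since [g <= M],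
   these points approach each other as [h] tends to 0, and continuity of [g] finishes the proof. *)
assert (Hk : exists c, Rabs (c - S t) <= Rabs (S (t + h) - S t) /\ S (t + h) - S t = g c * h).
{ destruct (Rle_dec (S t) (S (t + h))) as [Hle|Hle].
  - destruct (Hslope _ _ Hle) as [c [Hc He]]; rewrite !HS in He.
    exists c; split; [rewrite !Rabs_pos_eq by lra; lra | rewrite He; ring].
  - destruct (Hslope (S (t + h)) (S t)) as [c [Hc He]]; [lra|]; rewrite !HS in He.
    exists c; split; [rewrite !Rabs_left1 by lra; lra | lra]. }
destruct Hk as [c [Hc Hk]].
assert (Hcd : Rabs (c - S t) < d).
{ eapply Rle_lt_trans; [exact Hc|]; rewrite Hk, Rabs_mult, (Rabs_pos_eq (g c))
    by (pose proof (Hpos c); lra).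
  apply Rlt_div_r in Hhd; [|assumption].
  destruct (Hb c); pose proof (Rabs_pos h); nra. }
rewrite Hk; replace (g c * h / h) with (g c) by (field; assumption).
exact (Hd c Hcd).
Qed.

Definition clamp (a b x : R) : R := Rmax a (Rmin b x).

Lemma clamp_bounds a b x : a <= b -> a <= clamp a b x <= b.
Proof.
intros H; unfold clamp, Rmax, Rmin.
destruct (Rle_dec b x); destruct (Rle_dec a _); lra.
Qed.

Lemma clamp_id a b x : a <= x <= b -> clamp a b x = x.
Proof. intros H; unfold clamp; rewrite Rmin_right, Rmax_right by lra; reflexivity. Qed.

Lemma continuous_clamp a b x : continuous (clamp a b) x.
Proof.
apply filterlim_locally; intros e; exists e; intros y Hy.
change (Rabs (clamp a b y - clamp a b x) < e); change (Rabs (y - x) < e) in Hy.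
apply Rabs_def2 in Hy; unfold clamp, Rmax, Rmin.
repeat destruct Rle_dec; apply Rabs_def1; lra.
Qed.

(* Clamping makes a positive right-hand side on a compact interval globally
   bounded, so no local existence theory is needed. *)
Lemma autonomous_ode_clamped (g : R -> R) a b x0 :
  a <= b -> (forall x, a <= x <= b -> continuous g x /\ 0 < g x) ->
  exists (S : R -> R) (m M : R), S 0 = x0 /\ 0 < m <= M /\
    (forall t, is_derive S t (g (clamp a b (S t)))) /\
    (forall s t, s <= t -> m * (t - s) <= S t - S s <= M * (t - s)).
Proof.
intros Hab Hg.
assert (Hcp : forall c, a <= c <= b -> continuity_pt g c).
{ intros c Hc; apply continuity_pt_filterlim, Hg, Hc. }
destruct (continuity_ab_min g a b Hab Hcp) as [xm [Hxm Hxm']].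
destruct (continuity_ab_maj g a b Hab Hcp) as [xM [HxM HxM']].
destruct (autonomous_ode (fun x => g (clamp a b x)) (g xm) (g xM) x0) as [S [HS0 HS]].
- intros x; apply (continuous_comp (clamp a b) g); [apply continuous_clamp|].
  apply Hg, clamp_bounds, Hab.
- apply Hg, Hxm'.
- intros x; split; [apply Hxm | apply HxM]; apply clamp_bounds, Hab.
- exists S, (g xm), (g xM); split; [exact HS0|]; split; [|split].
  + split; [apply Hg, Hxm' | apply Hxm, HxM'].
  + exact HS.
  + intros s t Hst.
    destruct (mean_value S (fun w => g (clamp a b (S w))) s t Hst (fun w _ => HS w)) as [c [_ ->]].
    pose proof (clamp_bounds a b (S c) Hab) as Hc.
    pose proof (Hxm _ Hc); pose proof (HxM _ Hc); split; nra.
Qed.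

Lemma re_point_spherical th Om :
  0 < cos th -> re_point (sin th) Om = spherical th 0 0 Om.
Proof.
intros Hc; unfold re_point, spherical, meridian_point, mk3; rewrite sin_0, cos_0.
assert (Hs : sqrt (1 - sin th ^ 2) = cos th).
{ replace (1 - sin th ^ 2) with (Rsqr (cos th)) by (rewrite cos2; unfold Rsqr; ring).
  apply sqrt_Rsqr; lra. }
rewrite Hs; repeat match goal with |- (_, _) = (_, _) => apply f_equal2 end; ring.
Qed.

(** The trajectory is the uniform rotation with angular velocity [Om]. The equation is the
    colatitude equation with [ddth = 0]; its factor [u = sin th] makes it hold at the pole for every
    [Om]. *)
Lemma relative_equilibrium_re_point r V l l1 Om u :
  (forall q, S2 q -> 0 < c3 q -> V q = l (1 - c3 q ^ 2)) ->
  0 <= u < 1 -> is_derive l (u ^ 2) l1 ->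
  u * (sqrt (1 - u ^ 2) * Om ^ 2 - r * Om - 2 * l1 * sqrt (1 - u ^ 2)) = 0 ->
  relative_equilibrium r V (re_point u Om).
Proof.
intros Hcap Hu Hl Heq.
assert (Hsin : sin (asin u) = u) by (apply sin_asin; lra).
assert (Hcos : cos (asin u) = sqrt (1 - u ^ 2)).
{ rewrite cos_asin by lra; f_equal; unfold Rsqr; ring. }
pose proof (meridian_height u Hu) as Hz.
set (th := asin u) in *.
assert (Hrot : forall t, spherical th (Om * t) 0 Om = lifted_rot (Om * t) (re_point u Om)).
{ intros t; rewrite <- Hsin, re_point_spherical by lra.
  unfold spherical, lifted_rot, rot, mk3, c1, c2, c3; simpl; rewrite sin_0, cos_0.
  repeat match goal with |- (_, _) = (_, _) => apply f_equal2 end; ring. }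
exists (fun t => spherical th (Om * t) 0 Om); split; [|split].
- intros t _ _; split; [apply TS2_spherical|].
  exists (spherical_velocity th (Om * t) 0 Om 0 0); split.
  + apply (is_hamiltonian_vector_spherical r V l l1); try assumption.
    * lra.
    * rewrite Hcos, pow2_sqrt by nra; replace (1 - (1 - u ^ 2)) with (u ^ 2) by ring; exact Hl.
    * rewrite Hsin, Hcos; lra.
    * ring.
  + apply (is_derive_spherical (fun _ => th) (fun t => Om * t) (fun _ => 0) (fun _ => Om)).
    * apply is_derive_Rconst.
    * auto_derive; auto; ring.
    * apply is_derive_Rconst.
    * apply is_derive_Rconst.
- rewrite Hrot, Rmult_0_r; apply lifted_rot_0.
- intros t; exists (Om * t); apply Hrot.
Qed.

(** * Departing trajectories *)

(* On the momentum level of the relative equilibrium at height [zs] with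
   angular velocity [Om], where [r = 2 Om zs], the longitude moves with velocity
   [spin] and [/ 2 * th'^2 = kinetic th] on the energy level. *)
Definition spin (zs Om th : R) : R := Om + Om * (zs - cos th) ^ 2 / sin th ^ 2.

Definition kinetic (l : R -> R) (zs Om th : R) : R :=
  aug l (2 * Om * zs) Om zs - aug l (2 * Om * zs) Om (cos th)
  - / 2 * Om ^ 2 * (zs - cos th) ^ 4 / sin th ^ 2.

(** Multiplied by [th'], this is the equation of motion of the longitude for [r = 2 * Om * zs]. *)
Lemma is_derive_spin zs Om th :
  sin th <> 0 ->
  is_derive (spin zs Om) th
    ((2 * Om * zs - 2 * cos th * spin zs Om th) / sin th).
Proof.
intros Hs; unfold spin; auto_derive; [simpl; rewrite Rmult_1_r; auto|].
field; assumption.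
Qed.

(** The derivative is the right-hand side of the colatitude equation: differentiating
    [/ 2 * th'^2 = kinetic th] in time gives [th'' = kinetic' th]. *)
Lemma is_derive_kinetic l l1 zs Om th :
  sin th <> 0 -> is_derive l (1 - cos th ^ 2) l1 ->
  is_derive (kinetic l zs Om) th
    (sin th * cos th * spin zs Om th ^ 2 - 2 * Om * zs * sin th * spin zs Om th
     - 2 * l1 * sin th * cos th).
Proof.
intros Hs Hl; unfold kinetic, aug, spin; auto_derive.
- repeat split; first [eexists; exact Hl | exact I | simpl; rewrite Rmult_1_r; auto].
- change (Derive _ _) with (Derive l (1 - cos th ^ 2)); rewrite (is_derive_unique _ _ _ Hl); field; assumption.
Qed.

(** The inequality [zs - cos th <= sin th ^ 2] bounds the deviation of [spin] from [Om] by
    [Rabs Om * (zs - cos th)], uniformly up to the pole. The drop of [aug] bounds the colatitude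
    velocity. *)
Lemma spherical_near l zs Om ths th (e : posreal) :
  zs = cos ths -> 0 < cos th < zs -> 0 < kinetic l zs Om th ->
  Rabs (sin th - sin ths) < e / (2 * (Rabs Om + 1)) ->
  Rabs (cos th - zs) < e / (2 * (Rabs Om + 1)) ->
  sqrt (2 * (aug l (2 * Om * zs) Om zs - aug l (2 * Om * zs) Om (cos th))) < e ->
  ball (spherical ths 0 0 Om) e
    (spherical th 0 (sqrt (2 * kinetic l zs Om th)) (spin zs Om th)).
Proof.
intros Hzs Hc Hk Hs1 Hc1 HA.
pose proof (cond_pos e) as He; pose proof (Rabs_pos Om) as HOm.
assert (Hsmall : e / (2 * (Rabs Om + 1)) <= e / 2).
{ apply Rmult_le_compat_l; [lra|]; apply Rinv_le_contravar; lra. }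
assert (HOme : Rabs Om * (e / (2 * (Rabs Om + 1))) < e / 2).
{ apply (Rmult_lt_reg_r (2 * (Rabs Om + 1))); [lra|]; field_simplify; lra. }
pose proof (sin2_cos2 th) as Hsc; unfold Rsqr in Hsc.
pose proof (SIN_bound th) as Hsb; pose proof (COS_bound th) as Hcb; pose proof (COS_bound ths).
assert (Hs2 : zs - cos th <= sin th ^ 2) by nra.
assert (Hs2p : 0 < sin th ^ 2) by lra.
set (k := sqrt (2 * kinetic l zs Om th)).
assert (Hk0 : 0 <= k) by apply sqrt_pos.
assert (Hke : k < e).
{ eapply Rle_lt_trans; [|exact HA]; apply sqrt_le_1_alt.
  unfold kinetic.
  assert (0 <= Om ^ 2 * (zs - cos th) ^ 4 / sin th ^ 2).
  { apply Rdiv_le_0_compat; [|assumption].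
    replace (Om ^ 2 * (zs - cos th) ^ 4) with (Rsqr (Om * (zs - cos th) ^ 2))
      by (unfold Rsqr; ring); apply Rle_0_sqr. }
  lra. }
assert (Hsp : Rabs (spin zs Om th - Om) <= Rabs Om * (zs - cos th)).
{ unfold spin; replace (Om + _ - Om) with (Om * ((zs - cos th) ^ 2 / sin th ^ 2))
    by (unfold Rdiv; ring).
  rewrite Rabs_mult; apply Rmult_le_compat_l; [assumption|].
  rewrite Rabs_pos_eq by (apply Rdiv_le_0_compat; [nra | assumption]).
  apply Rle_div_l; [lra | nra]. }
assert (Hsp2 : Rabs (spin zs Om th - Om) < e / 2).
{ eapply Rle_lt_trans; [exact Hsp|]; rewrite Rabs_minus_sym, Rabs_pos_eq in Hc1 by lra.
  eapply Rle_lt_trans; [apply Rmult_le_compat_l; [assumption | apply Rlt_le, Hc1] | exact HOme]. }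
apply ball_phase; unfold spherical, mk3, c1, c2, c3; cbn [fst snd];
  rewrite ?sin_0, ?cos_0.
- replace (_ - _) with (sin th - sin ths) by ring; lra.
- replace (_ - _) with 0 by ring; rewrite Rabs_R0; lra.
- rewrite <- Hzs; lra.
- replace (_ - _) with (cos th * k) by ring.
  rewrite Rabs_pos_eq by nra; nra.
- replace (_ - _) with (sin th * (spin zs Om th - Om) + Om * (sin th - sin ths)) by ring.
  eapply Rle_lt_trans; [apply Rabs_triang|]; rewrite !Rabs_mult.
  assert (Rabs Om * Rabs (sin th - sin ths) < e / 2).
  { eapply Rle_lt_trans; [apply Rmult_le_compat_l; [assumption | apply Rlt_le, Hs1] | exact HOme]. }
  assert (Rabs (sin th) <= 1) by (apply Rabs_le; lra).
  pose proof (Rabs_pos (spin zs Om th - Om)); nra.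
- replace (_ - _) with (- (sin th * k)) by ring.
  rewrite Rabs_Ropp, Rabs_mult, (Rabs_pos_eq k) by assumption.
  assert (Rabs (sin th) <= 1) by (apply Rabs_le; lra); nra.
Qed.

(* The trajectory leaving the relative equilibrium: the colatitude solves
   [th' = sqrt (2 * kinetic th)] and the longitude is a quadrature. *)
Lemma departing_trajectory V l l1 zs Om a b th0 th1 :
  (forall q, S2 q -> 0 < c3 q -> V q = l (1 - c3 q ^ 2)) ->
  (forall s, 0 <= s < 1 -> is_derive l s (l1 s)) ->
  0 < a < th0 -> th0 < th1 < b -> b < PI / 2 ->
  (forall th, a <= th <= b -> 0 < kinetic l zs Om th) ->
  exists (ta tb t1 : R) (g : R -> phase),
    ta < 0 /\ 0 <= t1 < tb /\
    trajectory (2 * Om * zs) V ta tb g /\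
    g 0 = spherical th0 0 (sqrt (2 * kinetic l zs Om th0)) (spin zs Om th0) /\
    c3 (fst (g t1)) = cos th1.
Proof.
intros Hcap Hl Ha Hth1 Hb Hk.
pose proof PI_RGT_0 as HPI.
assert (Hsin : forall th, a <= th <= b -> 0 < sin th) by (intros; apply sin_gt_0; lra).
assert (Hcos : forall th, a <= th <= b -> 0 < cos th) by (intros; apply cos_gt_0; lra).
assert (Hld : forall th, a <= th <= b -> is_derive l (1 - cos th ^ 2) (l1 (1 - cos th ^ 2))).
{ intros th Hth; apply Hl; pose proof (Hcos th Hth); pose proof (Hsin th Hth).
  pose proof (sin2_cos2 th) as Hsc; unfold Rsqr in Hsc; nra. }
assert (HkD : forall th, a <= th <= b -> is_derive (kinetic l zs Om) th
    (sin th * cos th * spin zs Om th ^ 2 - 2 * Om * zs * sin th * spin zs Om th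
     - 2 * l1 (1 - cos th ^ 2) * sin th * cos th)).
{ intros th Hth; apply is_derive_kinetic; [pose proof (Hsin th Hth); lra | apply Hld, Hth]. }
pose (G := fun th => sqrt (2 * kinetic l zs Om th)).
destruct (autonomous_ode_clamped G a b th0) as [S [m [M [HS0 [Hm [HS HSb]]]]]].
{ lra. }
{ intros th Hth; split.
  - apply (continuous_comp (fun th => 2 * kinetic l zs Om th) sqrt); [|apply continuous_sqrt].
    apply (continuous_Rmult (fun _ => 2)); [apply continuous_const|].
    apply (ex_derive_continuous (K := R_AbsRing) (V := R_NormedModule)); eexists; apply HkD, Hth.
  - apply sqrt_lt_R0; pose proof (Hk th Hth); lra. }
assert (HScont : forall t, continuous S t).
{ intros t; apply (ex_derive_continuous (K := R_AbsRing) (V := R_NormedModule)).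
  eexists; apply HS. }
(* The speed of [S] is at least [m], so [th1] is reached by this time. *)
destruct (IVT_gen S 0 ((th1 - th0) / m) th1) as [t1 [Ht1 HSt1]].
{ intros t; apply continuity_pt_filterlim, HScont. }
{ assert (H0 : 0 <= (th1 - th0) / m) by (apply Rdiv_le_0_compat; lra).
  destruct (HSb _ _ H0) as [HSl _]; rewrite HS0 in *.
  replace (m * ((th1 - th0) / m - 0)) with (th1 - th0) in HSl by (field; lra).
  rewrite Rmin_left, Rmax_right by lra; lra. }
rewrite Rmin_left in Ht1 by (apply Rdiv_le_0_compat; lra).
(* The speed of [S] is at most [M], so between these times [S] stays in the interval from [a] to
   [b], where the clamp is inactive. *)
pose (ta := - ((th0 - a) / M)); pose (tb := t1 + (b - th1) / M).
assert (Hta : ta < 0).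
{ unfold ta; assert (0 < (th0 - a) / M) by (apply Rdiv_lt_0_compat; lra); lra. }
assert (Htb : t1 < tb).
{ unfold tb; assert (0 < (b - th1) / M) by (apply Rdiv_lt_0_compat; lra); lra. }
assert (HMa : M * ta = a - th0) by (unfold ta; field; lra).
assert (HMb : M * (tb - t1) = b - th1) by (unfold tb; field; lra).
assert (Hin : forall t, ta < t < tb -> a <= S t <= b).
{ intros t Ht; split.
  - destruct (Rle_dec t 0) as [H|H].
    + destruct (HSb t 0 H); rewrite HS0 in *; nra.
    + destruct (HSb 0 t ltac:(lra)); rewrite HS0 in *; nra.
  - destruct (Rle_dec t t1) as [H|H].
    + destruct (HSb t t1 H); rewrite HSt1 in *; nra.
    + destruct (HSb t1 t ltac:(lra)); rewrite HSt1 in *; nra. }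
pose (w := fun t => spin zs Om (clamp a b (S t))).
assert (Hw : forall t, continuous w t).
{ intros t; apply (continuous_comp (fun t => clamp a b (S t)) (spin zs Om)).
  - apply (continuous_comp S (clamp a b)); [apply HScont | apply continuous_clamp].
  - apply (ex_derive_continuous (K := R_AbsRing) (V := R_NormedModule)).
    eexists; apply is_derive_spin.
    pose proof (Hsin _ (clamp_bounds a b (S t) ltac:(lra))); lra. }
pose (ph := (fun t => RInt w 0 t) : R -> R).
assert (Hph : forall t, is_derive ph t (w t)).
{ intros t; apply (is_derive_RInt (V := R_NormedModule) w ph 0 t).
  - apply filter_forall; intros y; apply (RInt_correct (V := R_CompleteNormedModule)).
    apply (ex_RInt_continuous (V := R_CompleteNormedModule)); intros z _; apply Hw.
  - apply Hw. }
exists ta, tb, t1, (fun t => spherical (S t) (ph t) (G (S t)) (spin zs Om (S t))).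
split; [exact Hta|]; split; [lra|]; split; [|split].
- intros t Ht1' Ht2'; simpl in Ht1', Ht2'.
  split; [apply TS2_spherical|].
  pose proof (Hin t (conj Ht1' Ht2')) as Hst.
  pose proof (Hsin _ Hst) as Hsp.
  set (f := spin zs Om (S t)).
  exists (spherical_velocity (S t) (ph t) (G (S t)) f
    (sin (S t) * cos (S t) * f ^ 2 - 2 * Om * zs * sin (S t) * f
     - 2 * l1 (1 - cos (S t) ^ 2) * sin (S t) * cos (S t))
    (G (S t) * ((2 * Om * zs - 2 * cos (S t) * f) / sin (S t)))).
  assert (HSt : is_derive S t (G (S t))).
  { pose proof (HS t) as HSt; rewrite clamp_id in HSt by assumption; exact HSt. }
  split.
  + apply (is_hamiltonian_vector_spherical _ V l (l1 (1 - cos (S t) ^ 2))); auto.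
    field; lra.
  + apply (is_derive_spherical S ph (fun t => G (S t)) (fun t => spin zs Om (S t))).
    * exact HSt.
    * unfold w in Hph; pose proof (Hph t) as Hpt; rewrite clamp_id in Hpt by assumption; exact Hpt.
    * assert (HkS : is_derive (fun t => 2 * kinetic l zs Om (S t)) t
        (2 * (G (S t) * (sin (S t) * cos (S t) * f ^ 2 - 2 * Om * zs * sin (S t) * f
          - 2 * l1 (1 - cos (S t) ^ 2) * sin (S t) * cos (S t))))).
      { pose proof (is_derive_Rcomp _ S t _ _ (HkD _ Hst) HSt) as Hc.
        evar_last; [derive_arith | cbv beta; fold f; ring]. }
      unfold G; evar_last; [apply is_derive_sqrt; [exact HkS|]|].
      { pose proof (Hk _ Hst); lra. }
      cbv beta; change (sqrt (2 * kinetic l zs Om (S t))) with (G (S t)).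
      assert (0 < G (S t)) by (apply sqrt_lt_R0; pose proof (Hk _ Hst); lra).
      field; lra.
    * apply (is_derive_Rcomp (spin zs Om) S); [|exact HSt].
      apply is_derive_spin; lra.
- rewrite HS0; unfold ph; rewrite (RInt_point (V := R_CompleteNormedModule)); reflexivity.
- rewrite HSt1; reflexivity.
Qed.

(** The departing trajectories can start arbitrarily close to the relative equilibrium, yet all of
    them reach the fixed colatitude [th1] and so leave the invariant set of heights above
    [cos th1]. *)
Lemma not_G_stable_of_kinetic_pos V l l1 Om ths thm :
  (forall q, S2 q -> 0 < c3 q -> V q = l (1 - c3 q ^ 2)) ->
  (forall s, 0 <= s < 1 -> is_derive l s (l1 s)) ->
  0 <= ths < thm -> thm < PI / 2 ->
  continuous (aug l (2 * Om * cos ths) Om) (cos ths) ->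
  (forall th, ths < th <= thm -> 0 < kinetic l (cos ths) Om th) ->
  ~ G_stable (2 * Om * cos ths) V (re_point (sin ths) Om).
Proof.
intros Hcap Hl Hths Hthm HAc Hk Hst.
pose proof PI_RGT_0 as HPI.
set (zs := cos ths) in *.
assert (Hzs : 0 < zs) by (apply cos_gt_0; lra).
pose (th1 := (ths + thm) / 2).
assert (Hz1 : cos th1 < zs) by (apply cos_decreasing_1; unfold th1; lra).
destruct (Hst (fun x => cos th1 < c3 (fst x))) as [U' [HU' Hstay]].
{ intros theta y _ Hy; exact Hy. }
{ intros y [theta ->]; set (y := lifted_rot _ _).
  assert (Hl3 : locally y (fun x : phase => cos th1 < c3 (fst x))).
  { destruct (continuous_coordinates y) as [[_ [_ C3]] _].
    apply (C3 (fun v => cos th1 < v)), (open_gt (cos th1)).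
    unfold y; rewrite re_point_spherical by assumption; exact Hz1. }
  revert Hl3; unfold within; apply filter_imp; auto. }
destruct (HU' (re_point (sin ths) Om)) as [e He].
{ exists 0; symmetry; apply lifted_rot_0. }
rewrite re_point_spherical in He by assumption.
pose proof (Rabs_pos Om).
assert (Hd : 0 < e / (2 * (Rabs Om + 1))) by (apply Rdiv_lt_0_compat; [apply cond_pos | lra]).
pose (D := fun th => sqrt (2 * (aug l (2 * Om * zs) Om zs - aug l (2 * Om * zs) Om (cos th)))).
assert (HD0 : D ths = 0).
{ unfold D; fold zs; rewrite Rminus_diag, Rmult_0_r; apply sqrt_0. }
assert (HDc : continuous D ths).
{ assert (HAcos : continuous (fun th => aug l (2 * Om * zs) Om (cos th)) ths)
    by (apply (continuous_comp cos); [apply continuous_cos | exact HAc]).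
  apply (continuous_comp (fun th => 2 * (aug l (2 * Om * zs) Om zs - aug l (2 * Om * zs) Om (cos th)))
    sqrt); [|apply continuous_sqrt]; continuous_arith. }
assert (Hnear : locally ths (fun th =>
   Rabs (sin th - sin ths) < e / (2 * (Rabs Om + 1)) /\
   Rabs (cos th - zs) < e / (2 * (Rabs Om + 1)) /\ D th < e)).
{ apply filter_and; [|apply filter_and].
  - apply (proj1 (filterlim_locally _ _) (continuous_sin ths) (mkposreal _ Hd)).
  - apply (proj1 (filterlim_locally _ _) (continuous_cos ths) (mkposreal _ Hd)).
  - apply (HDc (fun v => v < e)), (open_lt e); rewrite HD0; apply cond_pos. }
destruct Hnear as [d Hnear]; pose proof (cond_pos d) as Hdp.
assert (Hth0 : exists th0, ths < th0 < th1 /\ th0 < ths + d).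
{ exists (ths + Rmin d (th1 - ths) / 2).
  assert (0 < Rmin d (th1 - ths)) by (apply Rmin_glb_lt; unfold th1; lra).
  pose proof (Rmin_l d (th1 - ths)); pose proof (Rmin_r d (th1 - ths)); lra. }
destruct Hth0 as [th0 [Hth0 Hth0d]].
destruct (Hnear th0) as [N1 [N2 N3]].
{ apply Rabs_def1; unfold minus, plus, opp; simpl; lra. }
(* The interval begins strictly beyond [ths], because [kinetic] is known to be positive only
   there. *)
destruct (departing_trajectory V l l1 zs Om ((ths + th0) / 2) thm th0 th1)
  as [ta [tb [t1 [g [Hta [Ht1 [Hg [Hg0 Hg1]]]]]]]]; try assumption.
{ lra. }
{ unfold th1 in *; lra. }
{ intros th Hth; apply Hk; lra. }
assert (Hesc : cos th1 < c3 (fst (g t1))).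
{ apply (Hstay ta tb g Hta (Rle_lt_trans _ _ _ (proj1 Ht1) (proj2 Ht1)) Hg);
    [|apply Ht1|apply Ht1].
  rewrite Hg0; apply He; [|apply TS2_spherical].
  apply (spherical_near l); try assumption.
  - reflexivity.
  - split; [apply cos_gt_0 | apply cos_decreasing_1]; unfold th1 in *; lra.
  - apply Hk; unfold th1 in *; lra. }
rewrite Hg1 in Hesc; lra.
Qed.

(* With [d = zs - z], the centrifugal defect [Om^2 d^4 / (1 - z^2)] is of higher
   order than [c d^2] because [d <= 1 - z^2], even at the pole. *)
Lemma not_G_stable_of_quadratic_drop V l l1 Om u c eps :
  (forall q, S2 q -> 0 < c3 q -> V q = l (1 - c3 q ^ 2)) ->
  (forall s, 0 <= s < 1 -> is_derive l s (l1 s)) ->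
  0 <= u < 1 -> 0 < c -> 0 < eps ->
  continuous (aug l (2 * Om * sqrt (1 - u ^ 2)) Om) (sqrt (1 - u ^ 2)) ->
  (forall z, Rabs (z - sqrt (1 - u ^ 2)) < eps -> z < sqrt (1 - u ^ 2) ->
     aug l (2 * Om * sqrt (1 - u ^ 2)) Om z
       + c * (z - sqrt (1 - u ^ 2)) ^ 2
     <= aug l (2 * Om * sqrt (1 - u ^ 2)) Om (sqrt (1 - u ^ 2))) ->
  ~ G_stable (2 * Om * sqrt (1 - u ^ 2)) V (re_point u Om).
Proof.
intros Hcap Hl Hu Hc Heps.
assert (Hsin : sin (asin u) = u) by (apply sin_asin; lra).
assert (Hcos : cos (asin u) = sqrt (1 - u ^ 2)).
{ rewrite cos_asin by lra; f_equal; unfold Rsqr; ring. }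
pose proof (meridian_height u Hu) as Hz.
assert (Hths : 0 <= asin u < PI / 2).
{ pose proof (asin_bound_lt u ltac:(lra)); split; [|lra].
  destruct (Rle_or_lt 0 (asin u)) as [|Hneg]; [assumption|].
  pose proof PI_RGT_0; pose proof (sin_lt_0_var (asin u) ltac:(lra) Hneg); lra. }
set (ths := asin u) in *.
rewrite <- Hcos, <- Hsin in *.
set (zs := cos ths) in *.
intros HAc Hdrop.
(* The second bound yields [Om ^ 2 * x < 2 * c] for [x = zs - cos th]; the summand 1 keeps the
   denominator positive when [Om = 0]. *)
pose (e := Rmin eps (2 * c / (Om ^ 2 + 1))).
assert (He : 0 < e).
{ apply Rmin_glb_lt; [assumption|]; apply Rdiv_lt_0_compat; nra. }
assert (Hloc : locally ths (fun th => Rabs (cos th - zs) < e)).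
{ apply (proj1 (filterlim_locally _ _) (continuous_cos ths) (mkposreal _ He)). }
destruct Hloc as [d Hd]; pose proof (cond_pos d).
pose (thm := ths + Rmin d (PI / 2 - ths) / 2).
assert (Hthm : ths < thm < PI / 2 /\ thm < ths + d).
{ unfold thm; assert (0 < Rmin d (PI / 2 - ths)) by (apply Rmin_glb_lt; lra).
  pose proof (Rmin_l d (PI / 2 - ths)); pose proof (Rmin_r d (PI / 2 - ths)); lra. }
apply (not_G_stable_of_kinetic_pos V l l1 Om ths thm); try assumption; try lra.
intros th Hth; unfold kinetic; fold zs.
assert (Hnear : Rabs (cos th - zs) < e).
{ apply Hd; apply Rabs_def1; unfold minus, plus, opp; simpl; lra. }
assert (Hlt : cos th < zs) by (apply cos_decreasing_1; lra).
assert (Hcpos : 0 < cos th) by (apply cos_gt_0; lra).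
pose proof (Hdrop (cos th) (Rlt_le_trans _ _ _ Hnear (Rmin_l _ _)) Hlt) as HA.
assert (Hde : (zs - cos th) * (Om ^ 2 + 1) < 2 * c).
{ apply Rlt_div_r; [nra|].
  rewrite Rabs_minus_sym, Rabs_pos_eq in Hnear by lra.
  exact (Rlt_le_trans _ _ _ Hnear (Rmin_r _ _)). }
pose proof (sin2_cos2 th) as Hsc; unfold Rsqr in Hsc.
pose proof (COS_bound ths); pose proof (COS_bound th).
set (x := zs - cos th) in *.
assert (Hx : 0 < x) by (unfold x; lra).
assert (Hs2 : x <= sin th ^ 2) by (unfold x, zs; nra).
assert (Hdef : / 2 * Om ^ 2 * x ^ 4 / sin th ^ 2 < c * x ^ 2).
{ apply Rlt_div_l; [lra|].
  assert (Om ^ 2 * x < 2 * c) by nra.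
  assert (Hx2 : 0 < x ^ 2) by nra.
  apply Rlt_le_trans with (c * x ^ 2 * x).
  - replace (/ 2 * Om ^ 2 * x ^ 4) with (x ^ 2 * x * (/ 2 * (Om ^ 2 * x))) by ring.
    replace (c * x ^ 2 * x) with (x ^ 2 * x * c) by ring.
    apply Rmult_lt_compat_l; [apply Rmult_lt_0_compat; lra | lra].
  - apply Rmult_le_compat_l; [apply Rmult_le_pos; lra | exact Hs2]. }
replace ((cos th - zs) ^ 2) with (x ^ 2) in HA by (unfold x; ring).
lra.
Qed.

(** * The derivative tests and the branch of double roots *)

Lemma is_derive_approx (f : R -> R) x d e :
  is_derive f x d -> 0 < e -> exists delta, 0 < delta /\
    forall y, Rabs (y - x) < delta -> Rabs (f y - f x - d * (y - x)) <= e * Rabs (y - x).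
Proof.
intros Hf He; apply is_derive_Reals in Hf; destruct (Hf e He) as [delta Hd].
exists delta; split; [apply cond_pos|]; intros y Hy.
destruct (Req_dec (y - x) 0) as [H0|H0].
{ replace y with x by lra; replace (f x - f x - d * (x - x)) with 0 by ring.
  rewrite Rminus_diag, Rabs_R0; lra. }
specialize (Hd (y - x) H0 Hy); replace (x + (y - x)) with y in Hd by ring.
replace (f y - f x - d * (y - x)) with (((f y - f x) / (y - x) - d) * (y - x)) by (field; lra).
rewrite Rabs_mult; apply Rmult_le_compat_r; [apply Rabs_pos | lra].
Qed.

(** Near [x0] the derivative [F1] differs from [a * (y - x0)] by at most half of its size, so
    [F - a / 4 * (y - x0) ^ 2] decreases before [x0] and increases after it. *)
Lemma quadratic_lower_bound (F F1 : R -> R) x0 a eps :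
  0 < eps -> (forall y, Rabs (y - x0) < eps -> is_derive F y (F1 y)) ->
  F1 x0 = 0 -> is_derive F1 x0 a -> 0 < a ->
  exists delta, 0 < delta /\
    forall y, Rabs (y - x0) < delta -> F x0 + a / 4 * (y - x0) ^ 2 <= F y.
Proof.
intros Heps HF H0 HF1 Ha.
destruct (is_derive_approx F1 x0 a (a / 2) HF1 ltac:(lra)) as [d [Hd Happ]].
exists (Rmin d eps); split; [apply Rmin_glb_lt; assumption|]; intros y Hy.
pose proof (Rmin_l d eps); pose proof (Rmin_r d eps).
apply Rabs_def2 in Hy.
pose (D := fun z => F z - a / 4 * ((z - x0) * (z - x0))).
assert (HH : forall z, Rabs (z - x0) < Rmin d eps -> is_derive D z (F1 z - a / 2 * (z - x0))).
{ intros z Hz; pose proof (HF z ltac:(lra)) as HFz; unfold D.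
  assert (Hid : is_derive (fun z : R => z) z 1) by (apply is_derive_Reals, derivable_pt_lim_id).
  evar_last; [derive_arith | cbv beta; field]. }
assert (Happ' : forall z, Rabs (z - x0) < Rmin d eps ->
   Rabs (F1 z - a * (z - x0)) <= a / 2 * Rabs (z - x0)).
{ intros z Hz; specialize (Happ z ltac:(lra)); rewrite H0 in Happ.
  replace (F1 z - 0) with (F1 z) in Happ by ring; exact Happ. }
assert (Hx0 : D x0 = F x0) by (unfold D; ring).
cut (D x0 <= D y); [rewrite Hx0; unfold D; simpl; lra|].
destruct (Rle_dec x0 y) as [Hle|Hle].
- destruct (mean_value D (fun z => F1 z - a / 2 * (z - x0)) x0 y Hle) as [c [Hc He]].
  { intros z Hz; apply HH, Rabs_def1; lra. }
  specialize (Happ' c ltac:(apply Rabs_def1; lra)).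
  rewrite (Rabs_pos_eq (c - x0)) in Happ' by lra; apply Rabs_le_between in Happ'.
  assert (0 <= F1 c - a / 2 * (c - x0)) by lra; nra.
- destruct (mean_value D (fun z => F1 z - a / 2 * (z - x0)) y x0) as [c [Hc He]]; [lra| |].
  { intros z Hz; apply HH, Rabs_def1; lra. }
  specialize (Happ' c ltac:(apply Rabs_def1; lra)).
  rewrite (Rabs_left1 (c - x0)) in Happ' by lra; apply Rabs_le_between in Happ'.
  assert (F1 c - a / 2 * (c - x0) <= 0) by lra; nra.
Qed.

Definition aug' (l1 : R -> R) (r Om z : R) : R :=
  Om ^ 2 * z - Om * r - 2 * z * l1 (1 - z ^ 2).

Lemma is_derive_aug l l1 r Om z :
  is_derive l (1 - z ^ 2) (l1 (1 - z ^ 2)) -> is_derive (aug l r Om) z (aug' l1 r Om z).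
Proof.
intros Hl; unfold aug, aug'; auto_derive.
- eexists; exact Hl.
- change (Derive _ _) with (Derive l (1 - z ^ 2)); rewrite (is_derive_unique _ _ _ Hl); field.
Qed.

Lemma is_derive_aug' l1 l2 r Om z :
  is_derive l1 (1 - z ^ 2) l2 ->
  is_derive (aug' l1 r Om) z (Om ^ 2 - 2 * l1 (1 - z ^ 2) + 4 * z ^ 2 * l2).
Proof.
intros Hl; unfold aug'; auto_derive.
- eexists; exact Hl.
- change (Derive _ _) with (Derive l1 (1 - z ^ 2)); rewrite (is_derive_unique _ _ _ Hl).
  replace (1 + - (z * (z * 1))) with (1 - z ^ 2) by ring; ring.
Qed.

(** Around the pole the window contains heights [z > 1], where [1 - z ^ 2] is negative; the
    extension of [W] below 0 makes two-sided derivatives of [aug] available there. *)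
Lemma height_window eps u : 0 < eps -> 0 <= u < 1 ->
  exists e, 0 < e /\ forall z, Rabs (z - sqrt (1 - u ^ 2)) < e -> - eps < 1 - z ^ 2 < 1.
Proof.
intros Heps Hu; pose proof (meridian_height u Hu) as Hz; set (zs := sqrt _) in *.
exists (Rmin zs (Rmin 1 (eps / 4))); split; [repeat apply Rmin_glb_lt; lra|].
intros z Hzz; apply Rabs_def2 in Hzz.
pose proof (Rmin_l zs (Rmin 1 (eps / 4))); pose proof (Rmin_r zs (Rmin 1 (eps / 4))).
pose proof (Rmin_l 1 (eps / 4)); pose proof (Rmin_r 1 (eps / 4)); nra.
Qed.

(** At the pole the angular velocity is thus a free parameter, which the stability and instability
    arguments set to [r / 2]. *)
Lemma re_point_0 Om : re_point 0 Om = straight_up_top.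
Proof.
unfold re_point, straight_up_top, meridian_point, e3, zero3, mk3.
replace (1 - 0 ^ 2) with 1 by ring; rewrite sqrt_1, Rmult_0_r; reflexivity.
Qed.

Lemma top_re r V l l1 :
  (forall q, S2 q -> 0 < c3 q -> V q = l (1 - c3 q ^ 2)) ->
  is_derive l 0 l1 -> relative_equilibrium r V straight_up_top.
Proof.
intros Hcap Hl; rewrite <- (re_point_0 0).
apply (relative_equilibrium_re_point r V l l1); [assumption | lra | | ring].
replace (0 ^ 2) with 0 by ring; exact Hl.
Qed.

(** The sphere has no heights above 1, so a negative slope of [A] at 1 already gives a strict
    minimum. The choice [Om = r / 2] minimizes this slope. *)
Lemma top_stable r V l l1 :
  SO2_invariant V -> (forall q, S2 q -> 0 < c3 q -> V q = l (1 - c3 q ^ 2)) ->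
  is_derive l 0 (l1 0) -> 0 < r ^ 2 + 8 * l1 0 ->
  stable_re r V straight_up_top.
Proof.
intros HV Hcap Hl Hr; split; [apply (top_re r V l (l1 0)); assumption|].
assert (Hz : sqrt (1 - 0 ^ 2) = 1) by (replace (1 - 0 ^ 2) with 1 by ring; apply sqrt_1).
assert (HA : is_derive (aug l r (r / 2)) 1 (aug' l1 r (r / 2) 1)).
{ apply is_derive_aug; replace (1 - 1 ^ 2) with 0 by ring; exact Hl. }
assert (Hd : aug' l1 r (r / 2) 1 < 0).
{ unfold aug'; replace (1 - 1 ^ 2) with 0 by ring; nra. }
set (d := aug' l1 r (r / 2) 1) in *.
destruct (is_derive_approx _ _ _ (- d / 2) HA ltac:(lra)) as [e [He Happ]].
rewrite <- (re_point_0 (r / 2)).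
apply (G_stable_of_strict_min r V l (r / 2) 0 e); try assumption; try lra; rewrite Hz.
- apply (ex_derive_continuous (K := R_AbsRing) (V := R_NormedModule)); eexists; exact HA.
- intros z Hze Hz1 Hzn; specialize (Happ z Hze).
  rewrite (Rabs_left (z - 1)) in Happ by lra; apply Rabs_le_between in Happ; nra.
Qed.

Lemma top_unstable r V l l1 :
  (forall q, S2 q -> 0 < c3 q -> V q = l (1 - c3 q ^ 2)) ->
  (forall s, 0 <= s < 1 -> is_derive l s (l1 s)) -> r ^ 2 + 8 * l1 0 < 0 ->
  unstable_re r V straight_up_top.
Proof.
intros Hcap Hl Hr; split; [apply (top_re r V l (l1 0)); [assumption | apply Hl; lra]|].
assert (Hz : sqrt (1 - 0 ^ 2) = 1) by (replace (1 - 0 ^ 2) with 1 by ring; apply sqrt_1).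
assert (HA : is_derive (aug l r (r / 2)) 1 (aug' l1 r (r / 2) 1)).
{ apply is_derive_aug; replace (1 - 1 ^ 2) with 0 by ring; apply Hl; lra. }
assert (Hd : 0 < aug' l1 r (r / 2) 1).
{ unfold aug'; replace (1 - 1 ^ 2) with 0 by ring; nra. }
set (d := aug' l1 r (r / 2) 1) in *.
destruct (is_derive_approx _ _ _ (d / 2) HA ltac:(lra)) as [e [He Happ]].
rewrite <- (re_point_0 (r / 2)).
(* Within distance 1 of the pole the linear drop of slope [d / 2] dominates the quadratic one with
   the same coefficient. *)
pose proof (not_G_stable_of_quadratic_drop V l l1 (r / 2) 0 (d / 2) (Rmin e 1)) as Hns.
rewrite Hz in Hns; replace (2 * (r / 2) * 1) with r in Hns by field.
apply Hns; try assumption; try lra.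
- apply Rmin_glb_lt; lra.
- apply (ex_derive_continuous (K := R_AbsRing) (V := R_NormedModule)); eexists; exact HA.
- intros z Hze Hz1.
  specialize (Happ z (Rlt_le_trans _ _ _ Hze (Rmin_l _ _))).
  pose proof (Rlt_le_trans _ _ _ Hze (Rmin_r _ _)) as Hze1.
  rewrite (Rabs_left (z - 1)) in Happ, Hze1 by lra; apply Rabs_le_between in Happ; nra.
Qed.

(** The second derivative test for [A]. The case [u = 0] decides the pole at [r = r0], where the
    slope used for the other values of [r] vanishes. *)
Lemma double_root_stability V l l1 l2 eps u Om :
  0 < eps -> SO2_invariant V ->
  (forall q, S2 q -> 0 < c3 q -> V q = l (1 - c3 q ^ 2)) ->
  (forall s, - eps < s < 1 -> is_derive l s (l1 s)) ->
  (forall s, - eps < s < 1 -> is_derive l1 s (l2 s)) ->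
  0 <= u < 1 -> Om ^ 2 = - 2 * l1 (u ^ 2) ->
  let r := 2 * Om * sqrt (1 - u ^ 2) in
  (0 < (1 - u ^ 2) * l2 (u ^ 2) - l1 (u ^ 2) -> stable_re r V (re_point u Om)) /\
  ((1 - u ^ 2) * l2 (u ^ 2) - l1 (u ^ 2) < 0 -> unstable_re r V (re_point u Om)).
Proof.
intros Heps HV Hcap Hl Hl1 Hu HOm r.
assert (Hu2 : - eps < u ^ 2 < 1) by nra.
pose proof (meridian_height u Hu) as Hz.
destruct (height_window eps u Heps Hu) as [e [He Hwin]].
assert (Hz2 : sqrt (1 - u ^ 2) ^ 2 = 1 - u ^ 2) by (apply pow2_sqrt; nra).
assert (Hre : relative_equilibrium r V (re_point u Om)).
{ apply (relative_equilibrium_re_point r V l (l1 (u ^ 2))); try assumption.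
  - apply Hl, Hu2.
  - unfold r; replace (l1 (u ^ 2)) with (- Om ^ 2 / 2) by lra; field. }
set (zs := sqrt (1 - u ^ 2)) in *.
assert (Hs : 1 - zs ^ 2 = u ^ 2) by lra.
assert (HA : forall z, Rabs (z - zs) < e -> is_derive (aug l r Om) z (aug' l1 r Om z)).
{ intros z Hzz; apply is_derive_aug, Hl, Hwin, Hzz. }
assert (Hzz : Rabs (zs - zs) < e) by (rewrite Rminus_diag, Rabs_R0; exact He).
assert (HAc : continuous (aug l r Om) zs).
{ apply (ex_derive_continuous (K := R_AbsRing) (V := R_NormedModule)); eexists; apply HA, Hzz. }
assert (HA0 : aug' l1 r Om zs = 0).
{ unfold aug'; rewrite Hs; unfold r; replace (l1 (u ^ 2)) with (- Om ^ 2 / 2) by lra; field. }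
assert (HA2 : is_derive (aug' l1 r Om) zs (4 * ((1 - u ^ 2) * l2 (u ^ 2) - l1 (u ^ 2)))).
{ evar_last; [apply (is_derive_aug' l1 (l2 (1 - zs ^ 2))), Hl1, Hwin, Hzz|].
  rewrite Hs, Hz2, HOm; ring. }
set (K := (1 - u ^ 2) * l2 (u ^ 2) - l1 (u ^ 2)) in *.
split; intros HK; (split; [exact Hre|]).
- destruct (quadratic_lower_bound (aug l r Om) (aug' l1 r Om) zs (4 * K) e) as [d [Hd Hq]];
    try assumption; try lra.
  apply (G_stable_of_strict_min r V l Om u d); try assumption; fold zs.
  intros z Hzd _ Hne; specialize (Hq z Hzd).
  assert (0 < (z - zs) ^ 2) by (apply pow2_gt_0; lra); nra.
- destruct (quadratic_lower_bound (fun z => - aug l r Om z) (fun z => - aug' l1 r Om z) zs (- (4 * K)) e)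
    as [d [Hd Hq]]; try assumption; try lra.
  + intros y Hy; apply (is_derive_opp (K := R_AbsRing) (V := R_NormedModule)), HA, Hy.
  + apply (is_derive_opp (K := R_AbsRing) (V := R_NormedModule)); exact HA2.
  + apply (not_G_stable_of_quadratic_drop V l l1 Om u (- K) d); try assumption; try lra.
    * intros s Hs'; apply Hl; lra.
    * fold zs; fold r; intros z Hzd _; specialize (Hq z Hzd); lra.
Qed.

(** The local inverse of [N] solves [S' = / N1 S] with [S 0 = 0], since [N (S y)] then has slope 1.
    Clamping the equation makes [S] continuous on the whole line. *)
Lemma inverse_branch (N N1 : R -> R) eps :
  0 < eps -> (forall s, - eps < s < 1 -> is_derive N s (N1 s)) ->
  (forall s, - eps < s < 1 -> continuous N1 s) ->
  N 0 = 0 -> 0 < N1 0 ->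
  exists (S : R -> R) delta, 0 < delta /\ S 0 = 0 /\ (forall y, continuous S y) /\
    forall y, 0 < y < delta -> 0 < S y < 1 /\ N (S y) = y /\ 0 < N1 (S y).
Proof.
intros Heps HN HN1 HN0 Hpos.
assert (Hloc : locally 0 (fun s => 0 < N1 s)).
{ apply (HN1 0 ltac:(lra) (fun v => 0 < v)), (open_gt 0), Hpos. }
destruct Hloc as [d Hd]; pose proof (cond_pos d).
pose (b := Rmin d 1 / 2).
assert (Hb : 0 < b < d /\ b < 1).
{ unfold b; assert (0 < Rmin d 1) by (apply Rmin_glb_lt; lra).
  pose proof (Rmin_l d 1); pose proof (Rmin_r d 1); lra. }
assert (Hpos' : forall s, 0 <= s <= b -> 0 < N1 s).
{ intros s Hs; apply Hd; apply Rabs_def1; unfold minus, plus, opp; simpl; lra. }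
destruct (autonomous_ode_clamped (fun s => / N1 s) 0 b 0) as [S [m [M [HS0 [Hm [HS HSb]]]]]].
{ lra. }
{ intros s Hs; pose proof (Hpos' s Hs); split.
  - apply continuous_Rinv_comp; [apply HN1; lra | lra].
  - apply Rinv_0_lt_compat; assumption. }
assert (HM : 0 < b / M) by (apply Rdiv_lt_0_compat; lra).
exists S, (b / M); split; [exact HM|]; split; [exact HS0|]; split.
{ intros y; apply (ex_derive_continuous (K := R_AbsRing) (V := R_NormedModule)).
  eexists; apply HS. }
assert (Hin : forall y, 0 <= y < b / M -> m * y <= S y <= b).
{ intros y Hy; destruct (HSb 0 y (proj1 Hy)) as [H1 H2]; rewrite HS0 in *.
  destruct Hy as [Hy1 Hy2]; apply Rlt_div_r in Hy2; lra. }
intros y Hy; destruct (Hin y ltac:(lra)) as [H1 H2].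
assert (0 < m * y) by (apply Rmult_lt_0_compat; lra).
split; [lra|]; split; [|apply Hpos'; lra].
destruct (mean_value (fun t => N (S t)) (fun _ => 1) 0 y) as [_ [_ He]]; [lra| |].
- intros t Ht; destruct (Hin t ltac:(lra)).
  assert (0 <= m * t) by (apply Rmult_le_pos; lra).
  evar_last; [apply (is_derive_Rcomp N S); [apply HN; lra | apply HS]|].
  rewrite clamp_id by lra; pose proof (Hpos' (S t) ltac:(lra)); field; lra.
- rewrite HS0, HN0 in He; lra.
Qed.

Lemma continuous_re_branch (u : R -> R) r0 :
  continuous u r0 -> u r0 = 0 ->
  continuous (fun r => re_point (u r) (r / (2 * sqrt (1 - u r ^ 2)))) r0.
Proof.
intros Hu Hu0.
assert (Hz : continuous (fun r => sqrt (1 - u r ^ 2)) r0).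
{ apply (continuous_comp u (fun v => sqrt (1 - v ^ 2))); [exact Hu|].
  apply (continuous_comp (fun v => 1 - v ^ 2) sqrt); [|apply continuous_sqrt].
  apply (ex_derive_continuous (K := R_AbsRing) (V := R_NormedModule)); auto_derive; exact I. }
unfold re_point, meridian_point.
apply continuous_mk_phase; try assumption; try apply continuous_const.
apply continuous_Rmult; [|exact Hu].
apply continuous_Rmult; [apply continuous_id|].
apply continuous_Rinv_comp.
- apply (continuous_Rmult (fun _ => 2)); [apply continuous_const | exact Hz].
- rewrite Hu0; replace (1 - 0 ^ 2) with 1 by ring; rewrite sqrt_1; lra.
Qed.

(** Only values to the right of [x] enter the limit, so the derivatives of [W] defined by [iota] can
    be read off a smooth extension. *)
Lemma right_derive_eq (f F : R -> R) x d del :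
  0 < del -> (forall t, x <= t < x + del -> f t = F t) -> is_derive F x d ->
  right_derive f x = d.
Proof.
intros Hdel Heq Hd.
apply (iota_filterlim_locally (V := R_CompleteNormedModule)
  (F := at_right 0) (fun h => (f (x + h) - f x) / h) d).
apply filterlim_locally; intros e.
apply is_derive_Reals in Hd; destruct (Hd e (cond_pos e)) as [rho Hrho].
assert (Hm : 0 < Rmin rho del) by (apply Rmin_glb_lt; [apply cond_pos | assumption]).
exists (mkposreal _ Hm); intros h Hh Hh0.
assert (Hh' : Rabs h < Rmin rho del).
{ rewrite <- (Rminus_0_r h); exact Hh. }
pose proof (Rlt_le_trans _ _ _ Hh' (Rmin_l _ _)) as Hh1.
pose proof (Rlt_le_trans _ _ _ Hh' (Rmin_r _ _)) as Hh2.
rewrite Rabs_pos_eq in Hh2 by lra.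
rewrite !Heq by lra; apply Hrho; [lra | exact Hh1].
Qed.

(* The branch of double roots [r^2 = - 8 (1 - s) l1 s], [s = u^2], emanates from
   [r0] towards the left for [sg = 1] and towards the right for [sg = -1]. *)
Lemma double_root_branch l1 l2 eps sg r0 :
  0 < eps -> sg = 1 \/ sg = -1 -> r0 ^ 2 = - 8 * l1 0 ->
  (forall s, - eps < s < 1 -> is_derive l1 s (l2 s)) ->
  (forall s, - eps < s < 1 -> continuous l2 s) ->
  0 < sg * (l2 0 - l1 0) ->
  exists (u : R -> R) del, 0 < del /\ u r0 = 0 /\ (forall r, continuous u r) /\
    forall r, 0 < sg * (r0 ^ 2 - r ^ 2) < del ->
      0 < u r < 1 /\ r ^ 2 = - 8 * (1 - u r ^ 2) * l1 (u r ^ 2) /\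
      0 < sg * ((1 - u r ^ 2) * l2 (u r ^ 2) - l1 (u r ^ 2)).
Proof.
intros Heps Hsg Hr0 Hl1 Hl2 Hpos.
assert (Hid : forall s, is_derive (fun z : R => z) s 1)
  by (intros s; apply is_derive_Reals, derivable_pt_lim_id).
(* On the branch this function equals [sg * (r0 ^ 2 - r ^ 2)]; the sign [sg] makes it increasing at
   0. *)
destruct (inverse_branch (fun s => 8 * sg * ((1 - s) * l1 s - l1 0))
  (fun s => 8 * (sg * ((1 - s) * l2 s - l1 s))) eps) as [S [del [Hdel [HS0 [HSc HS]]]]].
- exact Heps.
- intros s Hs; pose proof (Hl1 s Hs); pose proof (Hid s).
  evar_last; [derive_arith | cbv beta; ring].
- intros s Hs.
  pose proof (Hl2 s Hs); pose proof (continuous_id s).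
  assert (continuous l1 s).
  { apply (ex_derive_continuous (K := R_AbsRing) (V := R_NormedModule)).
    eexists; apply Hl1, Hs. }
  continuous_arith.
- ring.
- replace ((1 - 0) * l2 0 - l1 0) with (l2 0 - l1 0) by ring; lra.
- exists (fun r => sqrt (S (sg * (r0 ^ 2 - r ^ 2)))), del.
  split; [exact Hdel|]; split; [|split].
  + rewrite Rminus_diag, Rmult_0_r, HS0; apply sqrt_0.
  + intros r; apply (continuous_comp (fun r => S (sg * (r0 ^ 2 - r ^ 2))) sqrt);
      [|apply continuous_sqrt].
    apply (continuous_comp (fun r => sg * (r0 ^ 2 - r ^ 2)) S); [|apply HSc].
    apply (ex_derive_continuous (K := R_AbsRing) (V := R_NormedModule)); auto_derive; exact I.
  + intros r Hr; destruct (HS _ Hr) as [H1 [H2 H3]].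
    rewrite pow2_sqrt by lra; set (s := S _) in *.
    split; [split|split].
    * apply sqrt_lt_R0; lra.
    * rewrite <- sqrt_1; apply sqrt_lt_1_alt; lra.
    * destruct Hsg; subst sg; lra.
    * lra.
Qed.

Lemma filterlim_continuous_within {T U : UniformSpace} (f : T -> U) (P : T -> Prop) x y :
  continuous f x -> f x = y -> filterlim f (within P (locally x)) (locally y).
Proof.
intros Hf <- Q HQ; generalize (Hf Q HQ); unfold filtermap, within.
apply filter_imp; auto.
Qed.

Theorem theorem1p1 (V : R3 -> R) (W : R -> R)
    (V_smooth : C_infty_S2 V) (V_invariant : SO2_invariant V)
    (W_smooth : C_infty_01 W)
    (W_V : forall u : R, 0 <= u < 1 -> W (u ^ 2) = V (meridian_point u)) :
  let W' := right_derive W in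
  let W'' := right_derive W' in
  let r0 := sqrt (- 8 * W' 0) in
  (W' 0 > 0 ->
    forall r : R, r >= 0 -> stable_re r V straight_up_top) /\
  (W' 0 < 0 -> W'' 0 > W' 0 ->
    (forall r : R, r > r0 -> stable_re r V straight_up_top) /\
    (forall r : R, 0 <= r < r0 -> unstable_re r V straight_up_top) /\
    exists (delta : R) (u : R -> R) (x : R -> phase),
      0 < delta <= r0 /\
      (forall r : R, r0 - delta < r < r0 ->
        0 < u r < 1 /\ continuous u r /\
        stable_re r V (x r) /\ fst (x r) = meridian_point (u r)) /\
      filterlim u (at_left r0) (locally 0) /\
      filterlim x (at_left r0) (locally straight_up_top)) /\
  (W' 0 < 0 -> W'' 0 < W' 0 ->
    (forall r : R, 0 <= r <= r0 -> unstable_re r V straight_up_top) /\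
    (forall r : R, r > r0 -> stable_re r V straight_up_top) /\
    exists (delta : R) (u : R -> R) (x : R -> phase),
      0 < delta /\
      (forall r : R, r0 < r < r0 + delta ->
        0 < u r < 1 /\ continuous u r /\
        unstable_re r V (x r) /\ fst (x r) = meridian_point (u r)) /\
      filterlim u (at_right r0) (locally 0) /\
      filterlim x (at_right r0) (locally straight_up_top)).
Proof.
intros W' W'' r0.
destruct W_smooth as [eps [l [Heps [Hsm HWl]]]].
pose (l1 := Derive_n l 1); pose (l2 := Derive_n l 2).
assert (Hl : forall s, - eps < s < 1 -> is_derive l s (l1 s)).
{ intros s Hs; apply Derive_correct, (Hsm 1%nat s Hs). }
assert (Hl1 : forall s, - eps < s < 1 -> is_derive l1 s (l2 s)).
{ intros s Hs; apply Derive_correct, (Hsm 2%nat s Hs). }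
assert (Hl2 : forall s, - eps < s < 1 -> continuous l2 s).
{ intros s Hs; apply (ex_derive_continuous (K := R_AbsRing) (V := R_NormedModule)).
  apply (Hsm 3%nat s Hs). }
assert (HW1 : forall s, 0 <= s < 1 -> W' s = l1 s).
{ intros s Hs; apply (right_derive_eq W l s _ (1 - s)); [lra| |apply Hl; lra].
  intros t Ht; apply HWl; lra. }
assert (HW2 : W'' 0 = l2 0).
{ apply (right_derive_eq W' l1 0 _ 1); [lra| |apply Hl1; lra].
  intros t Ht; apply HW1; lra. }
assert (Hcap : forall q, S2 q -> 0 < c3 q -> V q = l (1 - c3 q ^ 2)).
{ intros q Hq Hz; rewrite (invariant_on_cap V W q) by assumption.
  pose proof (S2_c3_bound q Hq); apply HWl; nra. }
assert (Hl' : forall s, 0 <= s < 1 -> is_derive l s (l1 s)) by (intros; apply Hl; lra).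
assert (Hl0 : is_derive l 0 (l1 0)) by (apply Hl; lra).
unfold r0 in *; clear r0; rewrite HW2, (HW1 0 ltac:(lra)).
set (r0 := sqrt (- 8 * l1 0)).
assert (Hr0 : l1 0 < 0 -> 0 < r0 /\ r0 ^ 2 = - 8 * l1 0).
{ intros H; split; [apply sqrt_lt_R0; lra | apply pow2_sqrt; lra]. }
(* One construction serves both bifurcations: [sg = 1] gives the stable branch below [r0], [sg = -1]
   the unstable branch above it. *)
assert (Hbranch : forall sg, sg = 1 \/ sg = -1 -> l1 0 < 0 -> 0 < sg * (l2 0 - l1 0) ->
  exists (u : R -> R) (x : R -> phase) del,
    0 < del /\ (forall r, fst (x r) = meridian_point (u r)) /\
    (forall r, continuous u r) /\ u r0 = 0 /\
    continuous x r0 /\ x r0 = straight_up_top /\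
    forall r, 0 < sg * (r0 ^ 2 - r ^ 2) < del -> 0 < u r < 1 /\
      (sg = 1 -> stable_re r V (x r)) /\ (sg = -1 -> unstable_re r V (x r))).
{ intros sg Hsg Hneg Hpos; destruct (Hr0 Hneg) as [Hr0p Hr02].
  destruct (double_root_branch l1 l2 eps sg r0 Heps Hsg Hr02 Hl1 Hl2 Hpos)
    as [u [del [Hdel [Hu0 [Huc Hu]]]]].
  exists u, (fun r => re_point (u r) (r / (2 * sqrt (1 - u r ^ 2)))), del.
  split; [exact Hdel|]; split; [reflexivity|]; split; [exact Huc|]; split; [exact Hu0|].
  split; [apply continuous_re_branch; [apply Huc | exact Hu0]|].
  split; [rewrite Hu0; apply re_point_0|].
  intros r Hr; destruct (Hu r Hr) as [Hur [Hr2 HK]]; split; [exact Hur|].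
  pose proof (meridian_height (u r) ltac:(lra)) as Hz.
  assert (Hz2 : sqrt (1 - u r ^ 2) ^ 2 = 1 - u r ^ 2) by (apply pow2_sqrt; nra).
  destruct (double_root_stability V l l1 l2 eps (u r) (r / (2 * sqrt (1 - u r ^ 2))))
    as [Hst Hun]; try assumption; [lra| |].
  { set (z := sqrt (1 - u r ^ 2)) in *.
    replace ((r / (2 * z)) ^ 2) with (r ^ 2 / (4 * z ^ 2)) by (field; lra).
    rewrite Hr2, Hz2; field; nra. }
  replace (2 * (r / (2 * sqrt (1 - u r ^ 2))) * sqrt (1 - u r ^ 2)) with r in Hst, Hun
    by (field; lra).
  split; intros ->; [apply Hst | apply Hun]; lra. }
split; [|split].
- intros H r Hr; apply (top_stable r V l l1); try assumption; nra.
- intros Hneg HW; destruct (Hr0 Hneg) as [Hr0p Hr02]; split; [|split].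
  + intros r Hr; apply (top_stable r V l l1); try assumption; nra.
  + intros r Hr; apply (top_unstable r V l l1); try assumption; nra.
  + destruct (Hbranch 1) as [u [x [del [Hdel [Hfst [Huc [Hu0 [Hxc [Hx0 Hux]]]]]]]]];
      [tauto | assumption | lra |].
    (* For [0 < r < r0] the difference [r0 ^ 2 - r ^ 2] is at most [2 * r0 * (r0 - r)]; the bound
       [r0] keeps [r] positive. *)
    exists (Rmin r0 (del / (2 * r0))), u, x; split; [|split; [|split]].
    * split; [|apply Rmin_l]; apply Rmin_glb_lt; [assumption | apply Rdiv_lt_0_compat; lra].
    * intros r Hr.
      pose proof (Rmin_l r0 (del / (2 * r0))).
      assert (Hd : r0 - r < del / (2 * r0)) by (pose proof (Rmin_r r0 (del / (2 * r0))); lra).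
      apply Rlt_div_r in Hd; [|lra].
      destruct (Hux r) as [H1 [H2 _]]; [nra|]; auto.
    * apply (filterlim_continuous_within u); [apply Huc | exact Hu0].
    * apply (filterlim_continuous_within x); [exact Hxc | exact Hx0].
- intros Hneg HW; destruct (Hr0 Hneg) as [Hr0p Hr02]; split; [|split].
  + intros r Hr; destruct (Rle_lt_or_eq_dec r r0 (proj2 Hr)) as [Hlt| ->].
    * apply (top_unstable r V l l1); try assumption; nra.
    (* At the critical value [r0] the slope of [A] at the pole vanishes, and the sign of
       [l2 0 - l1 0] decides. *)
    * rewrite <- (re_point_0 (r0 / 2)).
      destruct (double_root_stability V l l1 l2 eps 0 (r0 / 2)) as [_ Hun];
        try assumption; [lra| |].
      { replace (0 ^ 2) with 0 by ring; lra. }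
      replace (1 - 0 ^ 2) with 1 in Hun by ring; replace (0 ^ 2) with 0 in Hun by ring.
      rewrite sqrt_1 in Hun; replace (2 * (r0 / 2) * 1) with r0 in Hun by field.
      apply Hun; lra.
  + intros r Hr; apply (top_stable r V l l1); try assumption; nra.
  + destruct (Hbranch (-1)) as [u [x [del [Hdel [Hfst [Huc [Hu0 [Hxc [Hx0 Hux]]]]]]]]];
      [tauto | assumption | lra |].
    assert (Hm : 0 < Rmin 1 (del / (2 * r0 + 1))).
    { apply Rmin_glb_lt; [lra | apply Rdiv_lt_0_compat; lra]. }
    (* The bound 1 gives [r + r0 < 2 * r0 + 1], which turns the bound on [r - r0] into one on
       [r ^ 2 - r0 ^ 2]. *)
    exists (Rmin 1 (del / (2 * r0 + 1))), u, x; split; [exact Hm|split; [|split]].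
    * intros r Hr.
      pose proof (Rmin_l 1 (del / (2 * r0 + 1))).
      assert (Hd : r - r0 < del / (2 * r0 + 1))
        by (pose proof (Rmin_r 1 (del / (2 * r0 + 1))); lra).
      apply Rlt_div_r in Hd; [|lra].
      destruct (Hux r) as [H1 [_ H2]]; [nra|]; auto.
    * apply (filterlim_continuous_within u); [apply Huc | exact Hu0].
    * apply (filterlim_continuous_within x); [exact Hxc | exact Hx0].
Qed.
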